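(* Let $A$ be a semi-simple complex unital Banach algebra with unit $e$, let $J=\operatorname{soc}(A)$ be its socle, and let $\pi:A\to A/J$ be the canonical projection. Let $a\in A$ be a B-Fredholm element of $A$ modulo $J$. Then there is $\varepsilon>0$ such that for every $\lambda\in\mathbb{C}$ with $0<|\lambda|<\varepsilon$, the element $a-\lambda e$ is a Fredholm element of $A$ modulo $J$ and $\mathbf{i}(a-\lambda e)=\mathbf{i}(a)$.
   Context: An element $x$ of an algebra $B$ is Drazin invertible if there exist $y\in B$ and $k\ge1$ with $xy=yx$, $yxy=y$, $x^kyx=x^k$; $y$ is unique and called the Drazin inverse of $x$. An element $a\in A$ is B-Fredholm modulo $J$ if $\pi(a)$ is Drazin invertible in $A/J$, and Fredholm modulo $J$ if $\pi(a)$ is invertible in $A/J$. The socle $\operatorname{soc}(A)$ is the sum of all minimal left ideals of $A$ (equivalently, the set of $x\in A$ such that left multiplication by $x$ on $Ap$ is of finite rank, for minimal idempotents $p$). On $\operatorname{soc}(A)$ the trace is $\tau(x)=\sum_{\lambda\in\sigma(x)}m(\lambda,x)\lambda$, where $\sigma(x)$ is the (finite) spectrum of $x$ and, for $\lambda\neq0$, $m(\lambda,x)$ is the algebraic multiplicity of $\lambda$, namely the rank of the Riesz projection of $x$ associated with $\lambda$, the rank of an element $u$ being $\sup_{y\in A}\#(\sigma(yu)\setminus\{0\})$. For an element $a$ that is B-Fredholm (in particular Fredholm) modulo $J$, its index is $\mathbf{i}(a)=\tau(aa_0-a_0a)$, where $a_0\in A$ is any element with $\pi(a_0)$ the Drazin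 inverse (for Fredholm elements, the inverse) of $\pi(a)$; this does not depend on the choice of $a_0$. *)

(* Defs.v *)
From HB Require Import structures.
From mathcomp Require Import all_boot all_order all_algebra.
From mathcomp Require Import all_classical all_reals all_analysis.
From mathcomp Require Import complex.
Set Implicit Arguments. Unset Strict Implicit. Unset Printing Implicit Defensive.
Import Order.TTheory GRing.Theory Num.Theory.
Import numFieldNormedType.Exports.
Local Open Scope classical_set_scope.
Local Open Scope ring_scope.
Local Open Scope complex_scope.

(* A complex unital Banach algebra is given as a complete normed C-module V
   together with a bilinear, associative, submultiplicative multiplication
   with unit e.  (HB cannot join normed modules with ring structures here, so
   the algebra structure is carried explicitly by a record.) *)
Record banach_algebra (K : numFieldType) (V : completeNormedModType K) :=
  BanachAlgebra {
    bmul : V -> V -> V;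
    bone : V;
    bmulA : forall x y z, bmul x (bmul y z) = bmul (bmul x y) z;
    bmul1l : forall x, bmul bone x = x;
    bmul1r : forall x, bmul x bone = x;
    bmulDl : forall x y z, bmul (x + y) z = bmul x z + bmul y z;
    bmulDr : forall x y z, bmul x (y + z) = bmul x y + bmul x z;
    bmulZl : forall (c : K) x y, bmul (c *: x) y = c *: bmul x y;
    bmulZr : forall (c : K) x y, bmul x (c *: y) = c *: bmul x y;
    bnormM : forall x y, `|bmul x y| <= `|x| * `|y|
  }.

Section BanachDefs.
Variable (R : realType).
Local Notation C := (complex R).
Variable (A : completeNormedModType C) (B : banach_algebra A).
Local Notation "x ** y" := (bmul B x y) (at level 40, left associativity).
Local Notation e := (bone B).

Definition bunit (x : A) : Prop := exists y, x ** y = e /\ y ** x = e.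
Definition binv (x : A) : A := xget 0 [set y | x ** y = e /\ y ** x = e].
Definition bpow (x : A) (k : nat) : A := iter k (bmul B x) e.

Definition spectrum (x : A) : set C :=
  [set mu | ~ bunit (x - mu *: e)].

(* semisimple: the Jacobson radical {x | forall y, e - y x invertible} is 0 *)
Definition semisimple : Prop :=
  forall x : A, (forall y : A, bunit (e - y ** x)) -> x = 0.

Definition left_ideal (L : set A) : Prop :=
  [/\ L 0, (forall x y, L x -> L y -> L (x - y)) & (forall a x, L x -> L (a ** x))].

Definition minimal_left_ideal (L : set A) : Prop :=
  [/\ left_ideal L, L <> [set 0] &
      forall M, left_ideal M -> M `<=` L -> M = [set 0] \/ M = L].

Definition socle : set A :=
  [set x | exists s : seq A,
      (forall u, u \in s -> exists L, minimal_left_ideal L /\ L u)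
      /\ x = \sum_(u <- s) u].

(* pi(b) is the Drazin inverse of pi(a) in A / soc(A), written out in A *)
Definition drazin_inv_mod_soc (a b : A) : Prop :=
  [/\ socle (a ** b - b ** a), socle (b ** a ** b - b) &
      exists k : nat, (0 < k)%N /\ socle (bpow a k ** b ** a - bpow a k)].

Definition BFredholm (a : A) : Prop := exists b, drazin_inv_mod_soc a b.

Definition Fredholm (a : A) : Prop :=
  exists b, socle (a ** b - e) /\ socle (b ** a - e).

(* Riemann sums (uniform partition of [0, 2 pi]) of the contour integral
   (1 / 2 pi i) \oint_{|mu - lam| = r} (mu e - x)^-1 d mu,
   with mu = lam + r e^{it}, d mu = i r e^{it} dt. *)
Definition riesz_sum (x : A) (lam r : C) (n : nat) : A :=
  n%:R^-1 *: \sum_(k < n)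
    (let t : R := 2 * pi * k%:R / n%:R in
     let w : C := cos t +i* sin t in
     (r * w) *: binv ((lam + r * w) *: e - x)).

Definition riesz_integral (x : A) (lam r : C) : A := limn (riesz_sum x lam r).

Definition isolating_radius (x : A) (lam : C) (r : C) : Prop :=
  0 < r /\ forall mu, spectrum x mu -> `|mu - lam| <= r -> mu = lam.

Definition riesz_proj (x : A) (lam : C) : A :=
  riesz_integral x lam (xget 1 (isolating_radius x lam)).

Definition rank_bounded (u : A) (n : nat) : Prop :=
  forall y : A, exists s : seq C,
    (size s <= n)%N /\ (spectrum (y ** u) `\ 0) `<=` [set z | z \in s].

(* rank u = sup_y #(sigma(y u) \ {0}) (the least such bound; 0 if infinite) *)
Definition rank (u : A) : nat :=
  xget 0%N [set n | rank_bounded u n /\ forall m, rank_bounded u m -> (n <= m)%N].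

Definition multiplicity (lam : C) (x : A) : nat := rank (riesz_proj x lam).

Definition trace (x : A) : C :=
  \sum_(lam \in spectrum x) ((multiplicity lam x)%:R * lam).

Definition bf_index (a : A) : C :=
  let a0 := xget 0 [set b | drazin_inv_mod_soc a b] in trace (a ** a0 - a0 ** a).

End BanachDefs.

(* Main.v *)
(* In a semisimple algebra the socle is the ideal of finite sums of "rank-one"
   elements, i.e. elements u with u A u contained in C u: a minimal left ideal is
   A p with p A p a normed division algebra, hence p A p = C p by Gelfand-Mazur.
   Setting T(u) = t when u^2 = t u and extending additively gives a well-defined
   trace on the socle with T(xy) = T(yx).  It agrees with the spectral trace:
   elements of the socle are algebraic, T vanishes on nilpotents, T of an
   idempotent is its rank, and the Riesz projections are the idempotents given by
   Bezout relations in C[x].  Both the Riesz integral and Gelfand-Mazur rest on the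
   identity (1/n) sum_k (1 - z / w_k)^-1 = (1 - z^n)^-1 over the n-th roots of
   unity w_k, which evaluates the Riemann sums of resolvents exactly.

   For x, y commuting modulo the socle put tau(x, y) = T(xy - yx); it depends only
   on the classes of x and y and satisfies the cyclic identity
   tau(xy, z) + tau(yz, x) + tau(zx, y) = 0, so tau(q, -) = 0 for q idempotent.
   If b is a Drazin inverse of a modulo the socle, r = (1 - lam b)^-1 and q = ab, then
   b r - sum_(j < k) lam^(-j-1) a^j (1 - q) inverts a - lam modulo the socle, and the
   properties of tau yield that its index is tau(a, b). *)
Require Import Defs.
From HB Require Import structures.
From mathcomp Require Import all_boot all_order all_algebra.
From mathcomp Require Import all_classical all_reals all_analysis.
From mathcomp Require Import complex ring lra.
From Corelib Require Setoid Morphisms.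
Set Implicit Arguments. Unset Strict Implicit. Unset Printing Implicit Defensive.
Import Order.TTheory GRing.Theory Num.Theory.
Import numFieldNormedType.Exports.
Local Open Scope classical_set_scope.
Local Open Scope ring_scope.

(** * Rank-one elements and the algebraic trace *)

Section FiniteRank.
Variables (F : fieldType) (A : algType F).
Implicit Types (u v w x y z h p r : A) (s : seq A) (c : F).

(** This is the form in which semisimplicity enters the algebraic sections. *)
Definition semiprime := forall x, (forall y, x * y * x = 0) -> x = 0.

(** Zero is included, which makes the predicate stable under multiplication on either side. *)
Definition rank_one u := forall y, exists c, u * y * u = c *: u.

Definition sum_of_rank_ones s x :=
  (forall u, u \in s -> rank_one u) /\ x = \sum_(u <- s) u.

Definition rank_le n x := exists2 s, (size s <= n)%N & sum_of_rank_ones s x.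

Definition finite_rank x := exists s, sum_of_rank_ones s x.

Lemma rank_oneMl z u : rank_one u -> rank_one (z * u).
Proof.
move=> hu y; have [c hc] := hu (y * z); exists c.
by rewrite scalerAr -hc !mulrA.
Qed.

Lemma rank_oneMr z u : rank_one u -> rank_one (u * z).
Proof.
move=> hu y; have [c hc] := hu (z * y); exists c.
by rewrite scalerAl -hc !mulrA.
Qed.

Lemma rank_le_finite n x : rank_le n x -> finite_rank x.
Proof. by case=> s _ hs; exists s. Qed.

Lemma finite_rank_le x : finite_rank x -> exists n, rank_le n x.
Proof. by case=> s hs; exists (size s), s. Qed.

Lemma rank_le0 x : rank_le 0 x -> x = 0.
Proof. by case=> [[|//]] _ [_ ->]; rewrite big_nil. Qed.

Lemma rank_le1 u : rank_one u -> rank_le 1 u.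
Proof.
move=> hu; exists [:: u] => //; split; last by rewrite big_seq1.
by move=> v; rewrite inE => /eqP->.
Qed.

Lemma rank_leD m n x y : rank_le m x -> rank_le n y -> rank_le (m + n) (x + y).
Proof.
case=> s ss [hs ->] [t st [ht ->]]; exists (s ++ t).
  by rewrite size_cat leq_add.
split; last by rewrite big_cat.
by move=> u; rewrite mem_cat => /orP[/hs|/ht].
Qed.

Lemma rank_leMl n z x : rank_le n x -> rank_le n (z * x).
Proof.
case=> s ss [hs ->]; exists (map (fun u => z * u) s); first by rewrite size_map.
split; last by rewrite big_map mulr_sumr.
by move=> u /mapP[v /hs hv ->]; apply: rank_oneMl.
Qed.

Lemma rank_leMr n z x : rank_le n x -> rank_le n (x * z).
Proof.
case=> s ss [hs ->]; exists (map (fun u => u * z) s); first by rewrite size_map.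
split; last by rewrite big_map mulr_suml.
by move=> u /mapP[v /hs hv ->]; apply: rank_oneMr.
Qed.

Lemma finite_rankMl z x : finite_rank x -> finite_rank (z * x).
Proof. by case/finite_rank_le=> n /(rank_leMl z)/rank_le_finite. Qed.

Lemma finite_rankMr z x : finite_rank x -> finite_rank (x * z).
Proof. by case/finite_rank_le=> n /(rank_leMr z)/rank_le_finite. Qed.

Lemma finite_rank0 : finite_rank 0.
Proof. by exists [::]; split=> //; rewrite big_nil. Qed.

Lemma finite_rankD x y : finite_rank x -> finite_rank y -> finite_rank (x + y).
Proof.
move=> /finite_rank_le[m hm] /finite_rank_le[n hn].
exact: rank_le_finite (rank_leD hm hn).
Qed.

Lemma finite_rankN x : finite_rank x -> finite_rank (- x).
Proof. by move=> hx; rewrite -mulN1r; apply: finite_rankMl. Qed.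

Lemma finite_rankB x y : finite_rank x -> finite_rank y -> finite_rank (x - y).
Proof. by move=> hx hy; apply/finite_rankD/finite_rankN. Qed.

Lemma finite_rankZ c x : finite_rank x -> finite_rank (c *: x).
Proof. by move=> hx; rewrite -[x]mul1r scalerAl; apply: finite_rankMl. Qed.

Lemma finite_rank_sum (I : Type) (t : seq I) (f : I -> A) :
  (forall i, finite_rank (f i)) -> finite_rank (\sum_(i <- t) f i).
Proof.
move=> hf; elim/big_ind: _ => //; first exact: finite_rank0.
exact: finite_rankD.
Qed.

(** The guard [u <> 0] leaves at most one candidate; for [u = 0] the set is empty and the default
    supplies the value 0. *)
Definition rank_one_trace u : F := xget 0 [set c | u <> 0 /\ u * u = c *: u].

Lemma rank_one_trace_eq u c : u <> 0 -> u * u = c *: u -> rank_one_trace u = c.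
Proof.
move=> u0 uc; rewrite /rank_one_trace; case: xgetP => [d _ [_ ud]|/(_ c)]; last first.
  by case.
have: (d - c) *: u = 0 by rewrite scalerBl -ud -uc subrr.
by move/eqP; rewrite scaler_eq0 subr_eq0 => /orP[/eqP//|/eqP].
Qed.

Lemma rank_one_trace0 : rank_one_trace 0 = 0.
Proof. by rewrite /rank_one_trace; case: xgetP => // d _ []. Qed.

(** Multiplying [u y u = c u] by [y] on either side shows that [y u] and [u y] both square to [c]
    times themselves. If one of them is 0, then [c = 0]. *)
Lemma rank_one_traceM u y c : u <> 0 -> u * y * u = c *: u ->
  rank_one_trace (y * u) = c /\ rank_one_trace (u * y) = c.
Proof.
move=> u0 uc; split.
  have [yu0|yu0] := pselect (y * u = 0); last first.
    by apply: rank_one_trace_eq => //; rewrite scalerAr -uc !mulrA.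
  move: uc; rewrite -mulrA yu0 mulr0 rank_one_trace0 => /esym/eqP.
  by rewrite scaler_eq0 => /orP[/eqP->|/eqP].
have [yu0|yu0] := pselect (u * y = 0); last first.
  by apply: rank_one_trace_eq => //; rewrite scalerAl -uc !mulrA.
move: uc; rewrite yu0 mul0r rank_one_trace0 => /esym/eqP.
by rewrite scaler_eq0 => /orP[/eqP->|/eqP].
Qed.

Lemma rank_one_traceC u y :
  rank_one u -> rank_one_trace (y * u) = rank_one_trace (u * y).
Proof.
move=> hu; have [->|u0] := pselect (u = 0); first by rewrite mulr0 mul0r.
by have [c uc] := hu y; have [-> ->] := rank_one_traceM u0 uc.
Qed.

Lemma rank_one_traceDl u y z : rank_one u ->
  rank_one_trace ((y + z) * u) = rank_one_trace (y * u) + rank_one_trace (z * u).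
Proof.
move=> hu; have [->|u0] := pselect (u = 0).
  by rewrite !mulr0 rank_one_trace0 addr0.
have [c uc] := hu y; have [d ud] := hu z.
have e : u * (y + z) * u = (c + d) *: u by rewrite mulrDr mulrDl uc ud scalerDl.
rewrite (rank_one_traceM u0 e).1.
by rewrite (rank_one_traceM u0 uc).1 (rank_one_traceM u0 ud).1.
Qed.

Lemma rank_one_traceDr u y z : rank_one u ->
  rank_one_trace (u * (y + z)) = rank_one_trace (u * y) + rank_one_trace (u * z).
Proof. by move=> hu; rewrite -(rank_one_traceC (y + z))// -(rank_one_traceC y)// -(rank_one_traceC z)// rank_one_traceDl. Qed.

Lemma rank_one_traceZ u c :
  rank_one u -> rank_one_trace (c *: u) = c * rank_one_trace u.
Proof.
move=> hu; have [->|u0] := pselect (u = 0).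
  by rewrite scaler0 rank_one_trace0 mulr0.
have [d ud] := hu 1; have e : u * (c *: 1) * u = (c * d) *: u.
  by rewrite -scalerAr -scalerAl ud scalerA.
have := (rank_one_traceM u0 e).1; rewrite -scalerAl mul1r => ->.
by have := (rank_one_traceM u0 ud).1; rewrite mul1r => ->.
Qed.

Lemma rank_one_trace_sumr u (t : seq A) : rank_one u ->
  rank_one_trace (u * \sum_(y <- t) y) = \sum_(y <- t) rank_one_trace (u * y).
Proof.
move=> hu; elim: t => [|y t IH]; first by rewrite !big_nil mulr0 rank_one_trace0.
by rewrite !big_cons rank_one_traceDr// IH.
Qed.

Section SemiPrime.
Hypothesis sp : semiprime.

(** Semiprimeness gives [z] with [h u z h u <> 0], so the scalar in [u (z h) u = c u] is nonzero and
    can be absorbed into [z]. *)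
Lemma rank_one_regular u h : rank_one u -> h * u <> 0 ->
  exists z, u * z * h * u = u.
Proof.
move=> hu hu0; have [z hz] : exists z, h * u * z * (h * u) <> 0.
  by apply/existsNP => H; apply: hu0; apply: sp.
have [c uc] := hu (z * h); have c0 : c != 0.
  apply/eqP => c0; apply: hz.
  by have := congr1 (fun t => h * t) uc; rewrite c0 scale0r mulr0 !mulrA.
exists (c^-1 *: z).
by rewrite -scalerAr -!scalerAl -(mulrA u) uc scalerA mulVf// scale1r.
Qed.


(* If [p] is a rank-one idempotent fixing the first summand, the remaining
   summands split as [u = (1 - p) u + p u]; the parts [(1 - p) u] form a shorter
   null sum, and the trace is linear on the right ideal [p A]. *)
Lemma rank_one_trace_sum0 s : (forall u, u \in s -> rank_one u) ->
  \sum_(u <- s) u = 0 -> \sum_(u <- s) rank_one_trace u = 0.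
Proof.
move: {2}(size s) (erefl (size s)) => n; elim: n s => [|n IH] [|u s] //=.
  by move=> *; rewrite big_nil.
move=> [sn] hs; rewrite !big_cons => us0.
have hu : rank_one u by apply: hs; rewrite mem_head.
have hs' v : v \in s -> rank_one v by move=> vs; apply: hs; rewrite inE vs orbT.
have [u0|u0] := pselect (u = 0).
  by move: us0; rewrite u0 rank_one_trace0 !add0r; apply: IH.
have [z hz] : exists z, u * z * 1 * u = u.
  by apply: rank_one_regular; rewrite ?mul1r.
rewrite mulr1 in hz; pose p := u * z; have hp : rank_one p by apply: rank_oneMr.
have sE : \sum_(v <- s) v = - u by apply/eqP; rewrite -addr_eq0 addrC us0.
have -> : \sum_(v <- s) rank_one_trace v =
   \sum_(v <- map (fun v => (1 - p) * v) s) rank_one_trace v +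
   \sum_(v <- s) rank_one_trace (p * v).
  rewrite big_map -big_split /=; apply: eq_big_seq => v /hs' hv.
  by rewrite -rank_one_traceDl// subrK mul1r.
rewrite IH ?size_map//; last 2 first.
  by move=> v /mapP[w /hs' hw ->]; apply: rank_oneMl.
  by rewrite big_map -mulr_sumr sE mulrN mulrBl mul1r /p hz subrr oppr0.
rewrite -rank_one_trace_sumr// sE mulrN /p hz -scaleN1r rank_one_traceZ//.
by rewrite mulN1r add0r subrr.
Qed.

Definition alg_trace x : F :=
  xget 0 [set c | exists2 s, sum_of_rank_ones s x & c = \sum_(u <- s) rank_one_trace u].

(** Joining one decomposition of [x] with the negatives of another gives a null sum, so
    [rank_one_trace_sum0] makes the two totals equal. *)
Lemma alg_trace_sum s x :
  sum_of_rank_ones s x -> alg_trace x = \sum_(u <- s) rank_one_trace u.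
Proof.
move=> hs; rewrite /alg_trace; case: xgetP => [c _ [t [ht xt] ->]|]; last first.
  by move=> /(_ (\sum_(u <- s) rank_one_trace u)) []; exists s.
have [hs1 xs] := hs; have hN u : rank_one u -> rank_one (- u).
  by move=> hu; rewrite -mulN1r; apply: rank_oneMl.
have := @rank_one_trace_sum0 (t ++ map -%R s); rewrite !big_cat !big_map /=.
have -> : \sum_(u <- s) rank_one_trace (- u) = - \sum_(u <- s) rank_one_trace u.
  rewrite -sumrN; apply: eq_big_seq => u /hs1 hu.
  by rewrite -scaleN1r rank_one_traceZ// mulN1r.
rewrite -sumrN in xs *; rewrite sumrN => H; apply/eqP; rewrite -subr_eq0.
apply/eqP/H; last by rewrite sumrN -xs -xt subrr.
move=> u; rewrite mem_cat => /orP[/ht//|/mapP[v /hs1 hv ->]]; exact: hN.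
Qed.

Lemma alg_trace_rank_one u : rank_one u -> alg_trace u = rank_one_trace u.
Proof.
move=> hu; rewrite (@alg_trace_sum [:: u]) ?big_seq1//.
by split; rewrite ?big_seq1// => v; rewrite inE => /eqP->.
Qed.

Lemma alg_traceD x y : finite_rank x -> finite_rank y ->
  alg_trace (x + y) = alg_trace x + alg_trace y.
Proof.
move=> [s hs] [t ht]; rewrite (@alg_trace_sum (s ++ t)).
  by rewrite (alg_trace_sum hs) (alg_trace_sum ht) big_cat.
case: hs ht => hs -> [ht ->]; split; last by rewrite big_cat.
by move=> u; rewrite mem_cat => /orP[/hs|/ht].
Qed.

Lemma alg_traceZ c x : finite_rank x -> alg_trace (c *: x) = c * alg_trace x.
Proof.
move=> [s hs]; rewrite (@alg_trace_sum (map ( *:%R c) s)).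
  rewrite (alg_trace_sum hs) big_map mulr_sumr; apply: eq_big_seq => u us.
  by rewrite rank_one_traceZ//; case: hs => /(_ _ us).
case: hs => hs ->; split; last by rewrite big_map scaler_sumr.
by move=> u /mapP[v /hs hv ->]; rewrite -[v]mul1r scalerAl; apply: rank_oneMl.
Qed.

Lemma alg_traceN x : finite_rank x -> alg_trace (- x) = - alg_trace x.
Proof. by move=> hx; rewrite -scaleN1r alg_traceZ// mulN1r. Qed.

Lemma alg_traceB x y : finite_rank x -> finite_rank y ->
  alg_trace (x - y) = alg_trace x - alg_trace y.
Proof.
by move=> hx hy; rewrite alg_traceD ?alg_traceN//; apply: finite_rankN.
Qed.

Lemma alg_trace0 : alg_trace 0 = 0.
Proof.
by rewrite (@alg_trace_sum [::]) ?big_nil//; split; rewrite ?big_nil.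
Qed.

Lemma alg_traceC x y : finite_rank x -> alg_trace (x * y) = alg_trace (y * x).
Proof.
move=> [s [hs ->]].
rewrite (@alg_trace_sum (map (fun u => u * y) s)); last first.
  split; last by rewrite big_map mulr_suml.
  by move=> u /mapP[v /hs hv ->]; apply: rank_oneMr.
rewrite (@alg_trace_sum (map (fun u => y * u) s)); last first.
  split; last by rewrite big_map mulr_sumr.
  by move=> u /mapP[v /hs hv ->]; apply: rank_oneMl.
by rewrite !big_map; apply: eq_big_seq => u /hs hu; rewrite (rank_one_traceC y).
Qed.

(** Semiprimeness gives [y] with [h x y h x <> 0]; expanding the last [x] into rank-one summands,
    one of them must keep the product nonzero. *)
Lemma rank_one_factor x h : finite_rank x -> h * x <> 0 ->
  exists2 w, rank_one (x * w) & h * (x * w) <> 0.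
Proof.
move=> [s [hs xE]] hx; have [y hy] : exists y, h * x * y * (h * x) <> 0.
  by apply/existsNP => H; apply: hx; apply: sp.
have [u us hu] : exists2 u, u \in s & h * x * y * (h * u) <> 0.
  apply: contrapT => H; apply: hy; rewrite {2}xE !mulr_sumr big_seq big1// => u us.
  by apply: contrapT => hu; apply: H; exists u.
exists (y * h * u); first by rewrite mulrA; apply: rank_oneMl; apply: hs.
by rewrite !mulrA in hu *.
Qed.

(* Steinitz exchange: left multiplication by an element killing a nonzero
   vector [x w] of the range of [x] lowers the rank. *)
Lemma rank_le_exchange n x h w : rank_le n.+1 x -> h * x * w = 0 -> x * w <> 0 ->
  rank_le n (h * x).
Proof.
move=> [s ss [hs xE]] hxw xw.
have [u us uw] : exists2 u, u \in s & u * w <> 0.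
  apply: contrapT => H; apply: xw; rewrite xE mulr_suml big_seq big1// => u us.
  by apply: contrapT => hu; apply: H; exists u.
have hu := hs _ us; have [c uc] := hu (w * 1).
have [z hz] : exists z, u * w * z * 1 * (u * w) = u * w.
  by apply: rank_one_regular; [apply: rank_oneMr|rewrite mul1r].
(* From [u w z u w = u w <> 0] the scalar [d] is 1, so that [v = w z u] satisfies [u v = u]. *)
have [d ud] := hu (w * z); have d1 : d = 1.
  apply/eqP; rewrite -subr_eq0; apply/negPn/negP => d1; apply: uw; apply/eqP.
  rewrite -[_ == _]orFb -(negPf d1) -scaler_eq0 scalerBl scale1r subr_eq0.
  by rewrite scalerAl -ud; apply/eqP; rewrite -[RHS]hz mulr1 !mulrA.
rewrite d1 scale1r in ud; pose v := w * z * u.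
have xE' : x = u + \sum_(y <- rem u s) y by rewrite xE (perm_big _ (perm_to_rem us)) big_cons.
(* Since [u v = u] and [h x v = 0], the element [h u] is expressed by the other summands, and [u]
   drops out of the sum. *)
have hv : h * u = - (h * (\sum_(y <- rem u s) y) * v).
  apply/eqP; rewrite -addr_eq0; apply/eqP.
  rewrite -[X in h * X + _]ud -(mulrA u) -/v (mulrA h) -mulrDl -mulrDr -xE'.
  by rewrite /v !mulrA hxw !mul0r.
have -> : h * x = h * (\sum_(y <- rem u s) y) * (1 - v).
  by rewrite xE' mulrDr hv mulrBr mulr1 addrC.
apply/rank_leMr/rank_leMl; exists (rem u s).
  by rewrite size_rem// -ltnS prednK//; case: (s) us.
by split=> // y /mem_rem/hs.
Qed.

(** Each nonzero diagonal block costs one unit of rank. The factor [h] kills a rank-one element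
    [x w] seen by the last block, so [h x] has smaller rank; the remaining blocks are unchanged
    because [f k * x * f j = 0] for [j < k]. *)
Lemma rank_le_orthogonal n x k (f : nat -> A) : rank_le n x ->
  (forall i j, (i < k)%N -> (j < k)%N -> i <> j -> f i * x * f j = 0) ->
  (forall i, (i < k)%N -> f i * x * f i <> 0) -> (k <= n)%N.
Proof.
elim: n x k => [|n IH] x [|k] // hx ho hd.
  by case: (hd 0%N) => //; rewrite (rank_le0 hx) mulr0 mul0r.
have rx : f k * x <> 0 by move=> H; apply: (hd k) => //; rewrite H mul0r.
have [w hw rw] := rank_one_factor (rank_le_finite hx) rx.
have [z hz] := rank_one_regular hw rw.
pose h := 1 - x * w * z * f k; apply: (IH (h * x)).
- apply: (@rank_le_exchange _ _ _ w) => //; last by move=> H; apply: rw; rewrite H mulr0.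
  by rewrite -mulrA /h mulrBl mul1r hz subrr.
- move=> i j ik jk ij.
  rewrite /h mulrBl mul1r mulrBr mulrBl ho ?(ltnW ik, ltnW jk, ltnS)//; try exact: ltnW.
  rewrite sub0r -!mulrA (mulrA (f k)) ho ?mulr0 ?oppr0//; first exact: ltnW.
  by move=> kj; rewrite kj ltnn in jk.
- move=> i ik; rewrite /h mulrBl mul1r mulrBr mulrBl.
  rewrite -[X in _ - X]mulrA -!mulrA (mulrA (f k)) ho ?mulr0 ?subr0 ?mulrA//.
  + by apply: hd; apply: ltnW.
  + exact: ltnW.
  + by move=> ki; rewrite ki ltnn in ik.
Qed.

Lemma rank_one_subidempotent p : finite_rank p -> p * p = p -> p <> 0 ->
  exists r, [/\ rank_one r, r <> 0, r * r = r, p * r = r & r * p = r].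
Proof.
move=> hp pp p0; have [|w hw gw] := @rank_one_factor p p hp; first by rewrite pp.
have [z hz] := rank_one_regular hw gw; exists (p * w * z * p); split.
- by rewrite -mulrA; apply: rank_oneMr.
- by move=> H; apply: gw; rewrite mulrA pp -hz H mul0r.
- by have := congr1 (fun t => t * z * p) hz; rewrite /= !mulrA.
- by rewrite !mulrA pp.
- by rewrite -!mulrA pp.
Qed.

(* [y] and [f] diagonalize [p] with the distinct nonzero eigenvalues 1, ..., m. *)
Lemma idempotent_diagonal n p : rank_le n p -> p * p = p ->
  exists m y (f : nat -> A), [/\ alg_trace p = m%:R, rank_le m p, y * p = y &
    forall i, (i < m)%N -> [/\ f i <> 0, p * f i = f i & y * f i = i.+1%:R *: f i]].
Proof.
elim: n p => [|n IH] p hn pp.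
  exists 0%N, 0, (fun=> 0); rewrite (rank_le0 hn) alg_trace0 mul0r; split=> //.
  by exists [::] => //; split=> //; rewrite big_nil.
have [->|p0] := pselect (p = 0).
  exists 0%N, 0, (fun=> 0); rewrite alg_trace0 mul0r; split=> //.
  by exists [::] => //; split=> //; rewrite big_nil.
have hp := rank_le_finite hn.
have [r [hr r0 rr pr rp]] := rank_one_subidempotent hp pp p0.
(* The complement [(1 - r) p] kills [r], a nonzero element of the range of [p], so the exchange
   lemma lowers its rank. *)
pose q := p - r; have qE : (1 - r) * p = q by rewrite mulrBl mul1r rp.
have qq : q * q = q by rewrite /q mulrBl !mulrBr pp pr rp rr subrr subr0.
have hq : rank_le n q.
  rewrite -qE; apply: (@rank_le_exchange _ _ _ r) => //; last by rewrite pr.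
  by rewrite qE /q mulrBl pr rr subrr.
have [m [y [f [trq mq yq hf]]]] := IH q hq qq.
have pE : p = q + r by rewrite subrK.
have qr : q * r = 0 by rewrite /q mulrBl pr rr subrr.
have rq : r * q = 0 by rewrite /q mulrBr rp rr subrr.
have qp : q * p = q by rewrite /q mulrBl pp rp.
(* The new direction [r] receives the eigenvalue [m + 1], distinct from those already used. *)
exists m.+1, (y + m.+1%:R *: r), (fun i => if i == m then r else f i); split.
- rewrite pE alg_traceD ?trq; last 2 first.
  + exact: rank_le_finite hq.
  + exact: rank_le_finite (rank_le1 hr).
  rewrite alg_trace_rank_one// (@rank_one_trace_eq r 1) ?scale1r//.
  by rewrite -natr1.
- by rewrite pE -addn1; apply: rank_leD => //; apply: rank_le1.
- by rewrite mulrDl -scalerAl rp -yq -mulrA qp.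
- move=> i; rewrite ltnS leq_eqVlt => /orP[/eqP->|im].
    rewrite eqxx; split=> //.
    by rewrite mulrDl -yq -mulrA qr mulr0 add0r -scalerAl rr.
  rewrite (ltn_eqF im); have [f0 qf yf] := hf i im; split=> //.
    by rewrite -qf mulrA (_ : p * q = q)// /q mulrBr pp pr.
  by rewrite mulrDl yf -scalerAl -qf (mulrA r) rq mul0r scaler0 addr0 qf.
Qed.

(** Induction on the rank. The last nonzero power of [x] yields an idempotent [r] of rank one with
    [x r = 0]. Passing to [(1 - r) x] lowers the rank, preserves nilpotency and leaves the trace
    unchanged, as [r x] and [x r] have the same trace. *)
Lemma alg_trace_nilpotent n x k : rank_le n x -> x ^+ k = 0 -> alg_trace x = 0.
Proof.
elim: n x k => [|n IH] x k hn xk; first by rewrite (rank_le0 hn) alg_trace0.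
have [->|x0] := pselect (x = 0); first exact: alg_trace0.
have [j [xj xj1]] : exists j, x ^+ j.+2 = 0 /\ x ^+ j.+1 <> 0.
  elim: k xk => [|[|k] IHk] xk.
  - by case: x0; rewrite -[x]mul1r -(expr0 x) xk mul0r.
  - by case: x0; rewrite -xk expr1.
  - by have [/IHk|] := pselect (x ^+ k.+1 = 0) => //; exists k.
have hx := rank_le_finite hn.
have hxj : finite_rank (x ^+ j.+1) by rewrite exprS; apply: finite_rankMr.
have [|w hw gw] := @rank_one_factor _ 1 hxj; first by rewrite mul1r.
have [z] := rank_one_regular hw gw; rewrite mulr1.
set g := _ * w in hw gw *; rewrite mul1r in gw => gz.
pose r := g * z; have rr : r * r = r by rewrite /r mulrA gz.
have xr : x * r = 0 by rewrite /r /g !mulrA -exprS xj !mul0r.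
pose h := 1 - r; have xh : x * h = x by rewrite /h mulrBr xr subr0 mulr1.
have hE : h * x = x - r * x by rewrite /h mulrBl mul1r.
have gE : x * (x ^+ j * w) = g by rewrite mulrA -exprS.
have hhx : rank_le n (h * x).
  apply: (@rank_le_exchange _ _ _ (x ^+ j * w)); rewrite ?gE//.
  by rewrite -mulrA gE /h mulrBl mul1r /r gz subrr.
have hk : (h * x) ^+ k.+1 = h * x ^+ k.+1.
  elim: k {xk} => [|k IHk]; first by rewrite !expr1.
  by rewrite exprS IHk mulrA -(mulrA h) xh -mulrA -exprS.
have := IH (h * x) k.+1 hhx; rewrite hk exprS xk !mulr0 hE => /(_ erefl).
rewrite alg_traceB//; last exact: finite_rankMl.
by rewrite -(alg_traceC r hx) xr alg_trace0 subr0.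
Qed.


(** * Linear dependence and algebraicity of finite-rank elements *)

Fixpoint in_span (W : seq A) v : Prop :=
  if W is w :: W' then exists c, in_span W' (v - c *: w) else v = 0.

Lemma in_spanD W x y : in_span W x -> in_span W y -> in_span W (x + y).
Proof.
elim: W x y => [|w W IH] x y /=; first by move=> -> ->; rewrite addr0.
move=> [c hc] [d hd]; exists (c + d).
by rewrite scalerDl opprD addrACA; apply: IH.
Qed.

Lemma in_spanZ W c x : in_span W x -> in_span W (c *: x).
Proof.
elim: W x => [|w W IH] x /=; first by move=> ->; rewrite scaler0.
by move=> [d hd]; exists (c * d); rewrite -scalerA -scalerBr; apply: IH.
Qed.

Lemma in_span_cat W W' x y : in_span W x -> in_span W' y -> in_span (W ++ W') (x + y).
Proof.
elim: W x => [|w W IH] x /=; first by move=> ->; rewrite add0r.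
by move=> [c hc] hy; exists c; rewrite addrAC; apply: IH.
Qed.

(** The space [u A v] has dimension at most one. If [w = u y0 v] is nonzero, regularity gives
    [u y0 v z u = u]; hence [u y v = u y0 (v z u y v)], a multiple of [w] since [v] has rank one. *)
Lemma rank_one_corner u v : rank_one u -> rank_one v ->
  exists w, forall y, exists c, u * y * v = c *: w.
Proof.
move=> hu hv; have [H|] := pselect (forall y, u * y * v = 0).
  by exists 0 => y; exists 0; rewrite H scaler0.
move=> /existsNP[y0 w0]; exists (u * y0 * v) => y.
have hw : rank_one (u * y0 * v) by apply: rank_oneMl.
have [|z hz] := @rank_one_regular _ 1 hw; first by rewrite mul1r.
rewrite mulr1 in hz.
have [c hc] := hu (y0 * v * z); have [d hd] := hv (z * u * y).
have c1 : c = 1.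
  apply/eqP; rewrite -subr_eq0; apply/negPn/negP => c1; apply: w0; apply/eqP.
  rewrite -[_ == _]orFb -(negPf c1) -scaler_eq0 scalerBl scale1r subr_eq0.
  by rewrite -mulrA scalerAl -hc; apply/eqP; move: hz; rewrite !mulrA.
exists d; rewrite scalerAr -hd -[u in LHS]scale1r -c1 -hc.
by rewrite !mulrA.
Qed.

Lemma rank_one_sum_corner s t :
  (forall u, u \in s -> rank_one u) -> (forall u, u \in t -> rank_one u) ->
  exists W, forall y, in_span W ((\sum_(u <- s) u) * y * \sum_(v <- t) v).
Proof.
move=> hs ht; elim: s hs => [|u s IHs] hs.
  by exists [::] => y; rewrite big_nil !mul0r.
have hu : rank_one u by apply: hs; rewrite mem_head.
have [W hW] : exists W, forall y, in_span W (u * y * \sum_(v <- t) v).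
  elim: t ht {IHs} => [|v t IHt] ht.
    by exists [::] => y; rewrite big_nil mulr0.
  have [|W hW] := IHt; first by move=> w wt; apply: ht; rewrite inE wt orbT.
  have [w hw] := rank_one_corner hu (ht v (mem_head _ _)).
  exists (w :: W) => y /=; have [c hc] := hw y; exists c.
  by rewrite big_cons mulrDr hc addrAC subrr add0r.
have [|W' hW'] := IHs; first by move=> v vs; apply: hs; rewrite inE vs orbT.
exists (W ++ W') => y; rewrite big_cons !mulrDl; exact: in_span_cat.
Qed.

Lemma horner_algZ x c (f : {poly F}) : horner_alg x (c *: f) = c *: horner_alg x f.
Proof. by rewrite linearZ /= -scalerAl mul1r. Qed.

(** Gaussian elimination on polynomials: subtracting multiples of a fixed [g k0] from the later,
    larger ones removes the coordinate along [w] and keeps the sizes increasing. *)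
Lemma span_dependent x (W : seq A) (g : nat -> {poly F}) :
  (forall k, size (g k) < size (g k.+1))%N ->
  (forall k, in_span W (horner_alg x (g k))) ->
  exists2 f : {poly F}, f != 0 & horner_alg x f = 0.
Proof.
elim: W g => [|w W IH] g hg hW.
  (* [g 0] may be the zero polynomial, whereas [g 1] has strictly larger size. *)
  by exists (g 1%N); [rewrite -size_poly_gt0 (leq_ltn_trans _ (hg 0%N))|exact: hW].
have [H|/existsNP[k0 hk0]] := pselect (forall k, in_span W (horner_alg x (g k))).
  exact: IH H.
have [c hc] := choice (hW : forall k, exists c, _).
have c0 : c k0 != 0.
  by apply/eqP => c0; apply: hk0; have := hc k0; rewrite c0 scale0r subr0.
have mono i j : (i < j)%N -> (size (g i) < size (g j))%N.
  exact: (homo_ltn ltn_trans hg).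
pose d k := c (k0 + k.+1)%N / c k0.
have sz k : size (g (k0 + k.+1)%N - d k *: g k0) = size (g (k0 + k.+1)%N).
  rewrite size_polyDl// size_polyN (leq_ltn_trans (size_scale_leq _ _))//.
  by apply: mono; rewrite addnS ltnS leq_addr.
apply: (IH (fun k => g (k0 + k.+1)%N - d k *: g k0)) => k.
  by rewrite !sz; apply: mono; rewrite ltn_add2l.
rewrite rmorphB /= horner_algZ.
have := in_spanD (hc (k0 + k.+1)%N) (in_spanZ (- d k) (hc k0)).
rewrite scalerBr scalerA addrACA -opprD -scalerDl mulNr /d divfK//.
by rewrite subrr scale0r subr0 scaleNr.
Qed.

(** The powers [x ^+ k.+2 = x * x ^+ k * x] all lie in [x A x], which is spanned by a finite
    list. *)
Lemma finite_rank_algebraic x : finite_rank x ->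
  exists2 f : {poly F}, f != 0 & horner_alg x f = 0.
Proof.
move=> [s [hs xE]]; have [W hW] := rank_one_sum_corner hs hs.
apply: (@span_dependent x W (fun k => 'X^(k.+2))) => k; first by rewrite !size_polyXn.
by rewrite rmorphXn /= horner_algX exprS exprSr mulrA {1 3}xE.
Qed.

End SemiPrime.
End FiniteRank.

(** * Spectral decomposition of finite-rank elements *)

Section Spectral.
Variables (F : closedFieldType) (A : algType F).
Implicit Types (x y p : A) (f g e : {poly F}) (L : seq F) (c z mu nu : F).
Hypothesis sp : semiprime A.

Definition invertible x := exists y, x * y = 1 /\ y * x = 1.
Definition eigen x z := ~ invertible (x - z *: 1).

Lemma horner_alg_XsubC x z : horner_alg x ('X - z%:P) = x - z *: 1.
Proof. by rewrite rmorphB /= horner_algX horner_algC. Qed.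

Lemma horner_alg_comm x f g :
  horner_alg x f * horner_alg x g = horner_alg x g * horner_alg x f.
Proof. by rewrite -!rmorphM mulrC. Qed.

Definition vanishing_poly L : {poly F} := \prod_(z <- L) ('X - z%:P).

(** For [z] outside [L], a Bezout relation between the annihilating polynomial and ['X - z%:P]
    inverts [x - z]. *)
Lemma eigen_vanishing x L m z : horner_alg x (vanishing_poly L ^+ m) = 0 ->
  eigen x z -> z \in L.
Proof.
move=> h0 hz; apply/negPn/negP => zL; apply: hz.
have : coprimep (vanishing_poly L ^+ m) ('X - z%:P).
  by apply: coprimep_expl; rewrite coprimep_XsubC root_prod_XsubC.
case/Bezout_eq1_coprimepP => -[u v] /= /(congr1 (horner_alg x)).
rewrite rmorphD !rmorphM /= h0 mulr0 add0r rmorph1 horner_alg_XsubC => H.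
exists (horner_alg x v); split=> //.
by rewrite -horner_alg_XsubC -horner_alg_comm horner_alg_XsubC.
Qed.

(** Factors [x - z] that are invertible can be cancelled; [g] collects the factors already kept. *)
Lemma eigen_subseq x (r : seq F) g : horner_alg x (vanishing_poly r * g) = 0 ->
  exists r', (forall z, z \in r' -> eigen x z) /\
             horner_alg x (vanishing_poly r' * g) = 0.
Proof.
elim: r g => [|z r IH] g hg; first by exists [::].
have [hz|] := pselect (eigen x z).
  have [|r' [h1 h2]] := IH (('X - z%:P) * g).
    by rewrite mulrCA mulrA; rewrite /vanishing_poly big_cons in hg.
  exists (z :: r'); split; first by move=> t; rewrite inE => /orP[/eqP->|/h1].
  by rewrite /vanishing_poly big_cons -mulrA mulrCA.
move=> /contrapT[y [_ yx]]; apply: IH.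
move: hg; rewrite /vanishing_poly big_cons -mulrA rmorphM /= horner_alg_XsubC.
by move=> /(congr1 (fun t => y * t)); rewrite mulrA yx mul1r mulr0.
Qed.

Lemma vanishing_poly_dvd (r : seq F) L : {subset r <= L} ->
  vanishing_poly r %| vanishing_poly L ^+ size r.
Proof.
elim: r => [|z r IH] rL; first by rewrite /vanishing_poly big_nil dvd1p.
rewrite {1}/vanishing_poly big_cons exprS dvdp_mul//.
  by rewrite dvdp_XsubCl root_prod_XsubC rL// mem_head.
by apply: IH => t tr; apply: rL; rewrite inE tr orbT.
Qed.

Lemma finite_rank_eigen x : finite_rank x -> exists L m, [/\ uniq L,
  (forall z, (z \in L) <-> eigen x z) & horner_alg x (vanishing_poly L ^+ m.+1) = 0].
Proof.
move=> /(finite_rank_algebraic sp)[f f0 hf].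
have [r fE] := closed_field_poly_normal f.
have [|r' [h1 h2]] := @eigen_subseq x r 1.
  move: hf; rewrite {1}fE horner_algZ mulr1 => /eqP.
  by rewrite scaler_eq0 lead_coef_eq0 (negPf f0) => /eqP.
(* Repeated roots are traded for a common exponent: [size r'] bounds every multiplicity, and the
   successor keeps the exponent positive. *)
have h3 : horner_alg x (vanishing_poly (undup r') ^+ (size r').+1) = 0.
  have /dvdpP[q hq] : vanishing_poly r' %| vanishing_poly (undup r') ^+ size r'.
    by apply: vanishing_poly_dvd => t; rewrite mem_undup.
  by rewrite mulr1 in h2; rewrite exprS hq !rmorphM /= h2 !mulr0.
exists (undup r'), (size r'); split=> //; first exact: undup_uniq.
move=> z; split; first by rewrite mem_undup => /h1.
exact: eigen_vanishing h3.
Qed.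

(* Polynomial form of the Riesz idempotent at [mu]. *)
Definition riesz_poly L m mu e :=
  (vanishing_poly (rem mu L) ^+ m %| e) /\ (('X - mu%:P) ^+ m %| 1 - e).

Lemma riesz_poly_exists L m mu : uniq L -> exists e, riesz_poly L m mu e.
Proof.
move=> uL; have : coprimep (vanishing_poly (rem mu L) ^+ m) (('X - mu%:P) ^+ m).
  apply/coprimep_expl/coprimep_expr.
  by rewrite coprimep_XsubC root_prod_XsubC mem_rem_uniqF.
case/Bezout_eq1_coprimepP => -[u v] /= H.
exists (u * vanishing_poly (rem mu L) ^+ m); split; first by rewrite dvdp_mull.
by rewrite -H addrAC subrr add0r dvdp_mull.
Qed.

(** * Riesz idempotents as polynomials in a finite-rank element *)

Section Riesz.
Variables (x : A) (L : seq F) (m : nat) (e : F -> {poly F}).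
Hypotheses (uL : uniq L) (hL : forall z, (z \in L) <-> eigen x z).
Hypothesis (h0 : horner_alg x (vanishing_poly L ^+ m.+1) = 0).
Hypothesis (he : forall mu, riesz_poly L m.+1 mu (e mu)).
Local Notation ev := (horner_alg x).

Lemma horner_alg_dvd f : vanishing_poly L ^+ m.+1 %| f -> ev f = 0.
Proof. by move/dvdpP => [q ->]; rewrite rmorphM /= h0 mulr0. Qed.

Lemma vanishing_poly_rem mu :
  mu \in L -> vanishing_poly L = ('X - mu%:P) * vanishing_poly (rem mu L).
Proof. by move=> muL; rewrite /vanishing_poly (perm_big _ (perm_to_rem muL)) big_cons. Qed.

Lemma riesz_nilpotent mu : mu \in L -> ev (('X - mu%:P) ^+ m.+1 * e mu) = 0.
Proof.
move=> muL; apply: horner_alg_dvd; rewrite (vanishing_poly_rem muL) exprMn.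
by rewrite dvdp_mul2l ?expf_neq0 ?polyXsubC_eq0//; case: (he mu).
Qed.

Lemma riesz_complement mu nu : mu \in L -> nu \in L -> mu != nu ->
  ('X - nu%:P) ^+ m.+1 %| e mu.
Proof.
move=> muL nuL mn; apply: dvdp_trans (he mu).1; rewrite dvdp_exp2r//.
by rewrite dvdp_XsubCl root_prod_XsubC mem_rem_uniq// inE eq_sym mn.
Qed.

Lemma riesz_idempotent mu : mu \in L -> ev (e mu) * ev (e mu) = ev (e mu).
Proof.
move=> muL; apply/eqP; rewrite eq_sym -subr_eq0 -rmorphM -rmorphB /=.
have [/dvdpP[q hq]] := (he mu).2.
by rewrite -{1}[e mu]mulr1 -mulrBr hq mulrCA [e mu * _]mulrC rmorphM /= riesz_nilpotent// mulr0.
Qed.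

Lemma riesz_orthogonal mu nu : mu \in L -> nu \in L -> mu != nu ->
  ev (e mu) * ev (e nu) = 0.
Proof.
move=> muL nuL mn; rewrite -rmorphM; apply: horner_alg_dvd.
rewrite (vanishing_poly_rem nuL) exprMn dvdp_mul//; first exact: riesz_complement.
by case: (he nu).
Qed.

Lemma vanishing_poly_exp_dvd L' f : uniq L' ->
  (forall mu, mu \in L' -> ('X - mu%:P) ^+ m.+1 %| f) ->
  vanishing_poly L' ^+ m.+1 %| f.
Proof.
elim: L' => [|z L' IH] /=; first by rewrite /vanishing_poly big_nil expr1n dvd1p.
move=> /andP[zL' uL'] H; rewrite /vanishing_poly big_cons exprMn.
rewrite Gauss_dvdp; last first.
  rewrite coprimep_sym; apply/coprimep_expl/coprimep_expr.
  by rewrite coprimep_XsubC root_prod_XsubC.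
rewrite H ?mem_head//=; apply: IH => // mu muL; apply: H.
by rewrite inE muL orbT.
Qed.

Lemma riesz_sum1 : \sum_(mu <- L) ev (e mu) = 1.
Proof.
apply/eqP; rewrite eq_sym -subr_eq0 -(rmorph1 ev) -rmorph_sum -rmorphB /=.
apply/eqP/horner_alg_dvd/vanishing_poly_exp_dvd => // mu muL.
rewrite (perm_big _ (perm_to_rem muL)) big_cons opprD addrA.
rewrite dvdp_add//; first by case: (he mu).
rewrite dvdpNr big_seq; elim/big_ind: _ => [|f g|nu]; [exact: dvdp0|exact: dvdp_add|].
rewrite mem_rem_uniq// inE => /andP[nm nuL].
exact: riesz_complement.
Qed.

(** Otherwise [1 - e mu], a multiple of ['X - mu%:P], would evaluate to 1 and [x - mu] would be
    invertible. *)
Lemma riesz_neq0 mu : mu \in L -> ev (e mu) <> 0.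
Proof.
move=> muL H; have := muL; rewrite hL; apply.
have [/dvdpP[q hq]] := (he mu).2.
have E : ev (q * ('X - mu%:P) ^+ m) * (x - mu *: 1) = 1.
  rewrite -horner_alg_XsubC -rmorphM -mulrA -exprSr -hq rmorphB /= H subr0.
  exact: rmorph1.
exists (ev (q * ('X - mu%:P) ^+ m)); split=> //.
by rewrite -horner_alg_XsubC horner_alg_comm horner_alg_XsubC.
Qed.

(** For [mu != 0], ['X] is invertible modulo [('X - mu%:P) ^+ m.+1], so the idempotent is a multiple
    of [x]. *)
Lemma riesz_finite_rank mu : finite_rank x -> mu \in L -> mu != 0 ->
  finite_rank (ev (e mu)).
Proof.
move=> hx muL mu0.
have : coprimep (('X - mu%:P) ^+ m.+1) 'X.
  rewrite coprimep_sym; apply/coprimep_expr; rewrite coprimep_XsubC.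
  by rewrite rootE hornerX.
case/Bezout_eq1_coprimepP => -[u v] /= /(congr1 (fun t => ev (t * e mu))).
rewrite mul1r mulrDl rmorphD /= -mulrA rmorphM /= riesz_nilpotent// mulr0 add0r => <-.
rewrite mulrAC rmorphM /= horner_algX; exact: finite_rankMl.
Qed.

(** On each Riesz component [x] differs from [mu] by a nilpotent, which has trace 0. The value
    [mu = 0] is treated apart because its idempotent may fail to have finite rank. *)
Lemma alg_trace_riesz : finite_rank x ->
  alg_trace x = \sum_(mu <- L) (if mu == 0 then 0 else alg_trace (ev (e mu)) * mu).
Proof.
move=> hx; rewrite -{1}[x]mulr1 -riesz_sum1 mulr_sumr.
have -> : alg_trace (\sum_(mu <- L) x * ev (e mu)) =
          \sum_(mu <- L) alg_trace (x * ev (e mu)).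
  elim: (L) => [|z L' IH]; first by rewrite !big_nil alg_trace0.
  rewrite !big_cons alg_traceD ?IH//; first exact: finite_rankMr.
  by apply: finite_rank_sum => i; apply: finite_rankMr.
apply: eq_big_seq => mu muL.
have nil y : finite_rank y -> y = (x - mu *: 1) * ev (e mu) -> alg_trace y = 0.
  move=> /finite_rank_le[n hn] yE; apply: (@alg_trace_nilpotent _ _ sp n y m.+1) => //.
  rewrite yE -horner_alg_XsubC -rmorphM -rmorphXn /= exprMn [e mu ^+ _]exprS mulrA.
  by rewrite rmorphM /= riesz_nilpotent// mul0r.
case: eqP => [mu0|/eqP mu0].
  by apply: nil; [exact: finite_rankMr|rewrite mu0 scale0r subr0].
have hem := riesz_finite_rank hx muL mu0.
have := nil _ _ erefl; rewrite mulrBl -scalerAl mul1r.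
rewrite alg_traceB ?alg_traceZ//; last 2 first.
  exact: finite_rankMr.
  exact: finite_rankZ.
by rewrite mulrC => H; apply/eqP; rewrite -subr_eq0 H//; apply: finite_rankB;
  [exact: finite_rankMr|exact: finite_rankZ].
Qed.

End Riesz.

(** The Riesz idempotents of [y u] at nonzero eigenvalues are orthogonal, commute with [y u] and are
    not killed by it, so [rank_le_orthogonal] bounds their number. *)
Lemma rank_le_eigen n u : rank_le n u -> forall y, exists s : seq F,
  (size s <= n)%N /\ forall z, eigen (y * u) z -> z != 0 -> z \in s.
Proof.
move=> hu y; have hz := rank_leMl y hu; set x := y * u in hz *.
have [L [m [uL hL h0]]] := finite_rank_eigen (rank_le_finite hz).
have [e he] := choice (fun mu => riesz_poly_exists m.+1 mu uL).
pose L' := [seq z <- L | z != 0]; exists L'; split; last first.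
  by move=> z /hL zL z0; rewrite mem_filter z0.
have uL' : uniq L' by apply: filter_uniq.
have inL i : (i < size L')%N -> (nth 0 L' i \in L) && (nth 0 L' i != 0).
  by move=> /(mem_nth 0); rewrite mem_filter andbC.
apply: (@rank_le_orthogonal _ _ sp n x _ (fun i => horner_alg x (e (nth 0 L' i)))) => //.
  move=> i j si sj ij; have /andP[Li _] := inL i si; have /andP[Lj _] := inL j sj.
  rewrite -{2}(horner_algX x) horner_alg_comm -mulrA (riesz_orthogonal _ h0 he)// ?mulr0//.
  by rewrite nth_uniq//; apply/eqP.
move=> i si; have /andP[Li i0] := inL i si; set mu := nth 0 L' i in Li i0 *.
rewrite -{2}(horner_algX x) horner_alg_comm -mulrA (riesz_idempotent h0 he)// => H.
apply: (riesz_neq0 hL he Li).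
have : coprimep (('X - mu%:P) ^+ m.+1) 'X.
  rewrite coprimep_sym; apply/coprimep_expr; rewrite coprimep_XsubC.
  by rewrite rootE hornerX.
case/Bezout_eq1_coprimepP => -[u' v'] /= /(congr1 (fun t => horner_alg x (t * e mu))).
rewrite mul1r mulrDl rmorphD /= -mulrA rmorphM /= (riesz_nilpotent h0 he)// mulr0 add0r => <-.
by rewrite -mulrA !rmorphM /= H mulr0.
Qed.

Lemma eigenvector_eigen x z y : y <> 0 -> x * y = z *: y -> eigen x z.
Proof.
move=> y0 hy [w [_ wx]]; apply: y0.
by rewrite -[y]mul1r -wx -mulrA mulrBl hy -scalerAl mul1r subrr mulr0.
Qed.

End Spectral.

(** * The commutator trace modulo the socle *)

Section Index.
Variables (F : numFieldType) (A : algType F).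
Hypothesis sp : semiprime A.
Implicit Types (a b x y z q g r : A) (c lam : F).

(** Equality of classes modulo the socle; the instances below allow rewriting in the quotient
    without constructing it. *)
Definition congr_soc x y := finite_rank (x - y).
Local Notation "x =~ y" := (congr_soc x y) (at level 70).

Lemma congr_soc_refl x : x =~ x.
Proof. by rewrite /congr_soc subrr; exact: finite_rank0. Qed.
#[local] Hint Resolve congr_soc_refl : core.

#[local] Instance congr_soc_equiv : RelationClasses.Equivalence congr_soc.
Proof.
split=> [x|x y xy|x y z xy yz] //.
- by rewrite /congr_soc -opprB; apply: finite_rankN.
- by rewrite /congr_soc -(subrK y x) -addrA; apply: finite_rankD.
Qed.

#[local] Instance congr_soc_add : Morphisms.Proper
  (Morphisms.respectful congr_soc (Morphisms.respectful congr_soc congr_soc)) +%R.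
Proof.
move=> x x' hx y y' hy; rewrite /congr_soc opprD addrACA; exact: finite_rankD.
Qed.

#[local] Instance congr_soc_opp : Morphisms.Proper
  (Morphisms.respectful congr_soc congr_soc) -%R.
Proof. by move=> x x' hx; rewrite /congr_soc -opprD; apply: finite_rankN. Qed.

#[local] Instance congr_soc_mul : Morphisms.Proper
  (Morphisms.respectful congr_soc (Morphisms.respectful congr_soc congr_soc)) *%R.
Proof.
move=> x x' hx y y' hy; rewrite /congr_soc.
have -> : x * y - x' * y' = (x - x') * y + x' * (y - y').
  by rewrite mulrBl mulrBr addrA subrK.
by apply: finite_rankD; [apply: finite_rankMr|apply: finite_rankMl].
Qed.

#[local] Instance congr_soc_scale c : Morphisms.Proper
  (Morphisms.respectful congr_soc congr_soc) ( *:%R c).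
Proof. by move=> x x' hx; rewrite /congr_soc -scalerBr; apply: finite_rankZ. Qed.

Definition drazin_mod a b := [/\ a * b =~ b * a, b * a * b =~ b &
  exists k, (0 < k)%N /\ a ^+ k * b * a =~ a ^+ k].

Lemma congr_soc_commX a b n : a * b =~ b * a -> a ^+ n * b =~ b * a ^+ n.
Proof.
move=> ab; elim: n => [|n IH]; first by rewrite expr0 mul1r mulr1.
by rewrite exprS -mulrA IH mulrA ab -mulrA.
Qed.

Lemma congr_soc_idemX a b n : a * b =~ b * a -> b * a * b =~ b ->
  b ^+ n.+1 * a ^+ n.+1 =~ b * a.
Proof.
move=> ab bab; elim: n => [|n IH]; first by rewrite !expr1.
have e : b * a =~ b * (b * a * a) by rewrite -{1}bab -(mulrA b) ab !mulrA.
by rewrite (exprS b) (exprSr a) -mulrA (mulrA _ _ a) IH -e.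
Qed.

(** Take [n + 1 = k + l]. The class of [b a] equals that of [b ^+ n.+1 * a ^+ n.+1], and this power
    of [a] absorbs [d a]; so [b a = b a d a]. By symmetry [d a] has the same value, and [b = b a b]
    then gives [b = d]. *)
Lemma drazin_mod_unique a b d : drazin_mod a b -> drazin_mod a d -> b =~ d.
Proof.
move=> [ab bab [k [k0 hk]]] [ac cac [l [l0 hl]]].
have hkn n : a ^+ (n + k) * b * a =~ a ^+ (n + k).
  by rewrite exprD -!mulrA (mulrA (a ^+ k)) hk.
have hln n : a ^+ (n + l) * d * a =~ a ^+ (n + l).
  by rewrite exprD -!mulrA (mulrA (a ^+ l)) hl.
pose n := (l + k).-1; have nE : n.+1 = (l + k)%N by rewrite prednK// addn_gt0 k0 orbT.
have nE' : n.+1 = (k + l)%N by rewrite addnC.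
have h1 : b * a =~ (b * a) * (d * a).
  rewrite -{1}(congr_soc_idemX n ab bab) nE' -(hln k) -nE' -(mulrA _ d).
  by rewrite mulrA congr_soc_idemX.
have h2 : d * a =~ (b * a) * (d * a).
  have cX : d ^+ n.+1 * a ^+ n.+1 =~ a ^+ n.+1 * d ^+ n.+1.
    have cX m : a ^+ m * d =~ d * a ^+ m by apply: congr_soc_commX.
    by symmetry in cX; have := @congr_soc_commX d (a ^+ n.+1) n.+1 (cX _).
  rewrite -{1}(congr_soc_idemX n ac cac) cX nE -(hkn l) -nE.
  rewrite (congr_soc_commX _ ab) -(mulrA b) -exprSr exprS (mulrA b) -(mulrA (b * a)) -cX.
  by rewrite congr_soc_idemX.
have h : b * a =~ d * a by rewrite h1 -h2.
by rewrite -bab h -mulrA ab h -ac mulrA cac.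
Qed.

(** * Calculus of commutator traces *)

Definition commutator_trace x y := alg_trace (x * y - y * x).
Local Notation tau := commutator_trace.

Lemma tauN x y : x * y =~ y * x -> tau x y = - tau y x.
Proof.
move=> xy; have yx : y * x =~ x * y by symmetry.
by rewrite /tau -alg_traceN// opprB.
Qed.

Lemma tauDr x y z : x * y =~ y * x -> x * z =~ z * x ->
  tau x (y + z) = tau x y + tau x z.
Proof.
by move=> xy xz; rewrite /tau mulrDr mulrDl opprD addrACA alg_traceD.
Qed.

Lemma tauZr c x y : x * y =~ y * x -> tau x (c *: y) = c * tau x y.
Proof. by move=> xy; rewrite /tau -scalerAr -scalerAl -scalerBr alg_traceZ. Qed.

Lemma tau_congr x y z : x * y =~ y * x -> y =~ z -> tau x y = tau x z.
Proof.
move=> xy yz; have xz : x * z =~ z * x by rewrite -yz.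
rewrite -[in LHS](subrK z y) /tau mulrDr mulrDl opprD addrACA alg_traceD//; last first.
  by apply: finite_rankB; [apply: finite_rankMl|apply: finite_rankMr].
rewrite alg_traceB; [|exact: sp|exact: finite_rankMl|exact: finite_rankMr].
by rewrite (alg_traceC sp x yz) subrr add0r.
Qed.

Lemma congr_soc_commM x y z : x * z =~ z * x -> y * z =~ z * y ->
  (x * y) * z =~ z * (x * y).
Proof. by move=> xz yz; rewrite -mulrA yz mulrA xz mulrA. Qed.

(* The cyclic identity [xy, z] + [yz, x] + [zx, y] = 0. *)
Lemma tauM x y z : x * y =~ y * x -> y * z =~ z * y -> x * z =~ z * x ->
  tau (x * y) z = tau x (y * z) + tau y (z * x).
Proof.
move=> xy yz xz.
have h1 : x * (y * z) =~ y * z * x by symmetry; apply: congr_soc_commM => //; symmetry.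
have h2 : y * (z * x) =~ z * x * y by symmetry; apply: congr_soc_commM => //; symmetry.
rewrite /tau -alg_traceD//; congr alg_trace.
by rewrite !mulrA addrA subrK.
Qed.

(** Replacing [q] by [q q] in the cyclic identity gives [tau q w = 2 tau q (q w)]. For [w = q z]
    this forces [tau q (q z) = 0], and then [w = z] gives the claim. *)
Lemma tau_idem q z : q * q =~ q -> q * z =~ z * q -> tau q z = 0.
Proof.
move=> qq qz; have qq2 w : q * w =~ w * q -> q * (q * w) =~ q * w * q.
  by move=> qw; rewrite {1}qw mulrA.
have dbl w : q * w =~ w * q -> tau q w = tau q (q * w) + tau q (q * w).
  move=> qw; have qqw := qq2 w qw.
  have wqq : w * (q * q) =~ q * q * w by rewrite !mulrA -qw -mulrA -qw mulrA.
  rewrite {1}tauN// (@tau_congr w q (q * q)); [|by symmetry|by symmetry].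
  rewrite -tauN; last by symmetry.
  rewrite tauM//; congr (_ + _); apply: tau_congr; last by symmetry.
  by rewrite -qw.
have := dbl (q * z); rewrite (dbl z)// => H.
have E : tau q (q * z) = tau q (q * (q * z)).
  apply: tau_congr; first exact: qq2.
  by rewrite mulrA qq.
have : tau q (q * z) = tau q (q * z) + tau q (q * z).
  by rewrite {2 3}E; apply/dbl/qq2.
by move/eqP; rewrite -subr_eq0 opprD addrA subrr sub0r oppr_eq0 => /eqP->; rewrite addr0.
Qed.

(** Power rule for the derivation-like map [tau _ z], by iterating the cyclic identity. *)
Lemma tauX a z n : a * z =~ z * a -> tau (a ^+ n.+1) z = n.+1%:R * tau a (a ^+ n * z).
Proof.
elim: n z => [|n IH] z az; first by rewrite expr1 expr0 !mul1r.
have aX m : a ^+ m * z =~ z * a ^+ m by apply: congr_soc_commX.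
have aza : a * (z * a) =~ z * a * a by rewrite mulrA az.
rewrite exprS tauM//; last by rewrite -exprS -exprSr.
rewrite IH// -[n.+2%:R]natr1 mulrDl mul1r addrC; congr (_ * _ + _).
have E : a ^+ n * (z * a) =~ a ^+ n.+1 * z.
  by rewrite mulrA aX -mulrA -exprSr -aX.
by apply: tau_congr => //; rewrite mulrA -exprS E mulrA.
Qed.

Lemma congr_soc_comm_resolvent a b r lam :
  (1 - lam *: b) * r = 1 -> r * (1 - lam *: b) = 1 ->
  a * b =~ b * a -> a * r =~ r * a.
Proof.
move=> br rb ab.
have {1}-> : a * r = r * ((1 - lam *: b) * a) * r by rewrite mulrA rb mul1r.
have -> : r * a = r * (a * (1 - lam *: b)) * r by rewrite -!mulrA br mulr1.
have e : (1 - lam *: b) * a =~ a * (1 - lam *: b).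
  by rewrite mulrBl mulrBr mul1r mulr1 -scalerAl -scalerAr ab.
by rewrite e.
Qed.

Lemma fredholm_perturbation a b r lam : lam != 0 ->
  (1 - lam *: b) * r = 1 -> r * (1 - lam *: b) = 1 -> drazin_mod a b ->
  exists h, [/\ (a - lam *: 1) * h =~ 1, h * (a - lam *: 1) =~ 1 & tau a h = tau a b].
Proof.
move=> lam0 br rb [ab bab [k [k0 hk]]].
(* Modulo the socle, [q] is idempotent. On its range [g] inverts [a - lam]; on the complement
   [a ^+ k] vanishes and the truncated geometric series [- S] inverts it. *)
pose q := a * b; pose g := b * r; pose u := lam^-1 *: a.
pose S := lam^-1 *: \sum_(j < k) u ^+ j.
have ar : a * r =~ r * a by apply: congr_soc_comm_resolvent br rb ab.
have rE : r = 1 + lam *: g.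
  by rewrite /g scalerAl -[X in X + _]br -mulrDl subrK mul1r.
have rE' : r = 1 + lam *: (r * b).
  by rewrite scalerAr -[X in X + _]rb -mulrDr subrK mulr1.
have rbE : r * b = b * r.
  move: rE'; rewrite {1}rE => /addrI/(congr1 (fun t => lam^-1 *: t)).
  by rewrite !scalerA mulVf// !scale1r.
have ag : a * g =~ g * a by symmetry; apply: congr_soc_commM; symmetry.
have qq : q * q =~ q by rewrite /q -mulrA (mulrA b) bab.
have qb : q * b =~ b by rewrite /q ab -mulrA -/q /q mulrA bab.
have qg : q * g =~ g by rewrite /g mulrA qb.
have aq : a * q =~ q * a by rewrite /q -mulrA -ab.
have qa j : a ^+ j * q =~ q * a ^+ j by apply: congr_soc_commX.
have bq : b * q =~ q * b by rewrite qb /q mulrA bab.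
have gq : g * q =~ q * g.
  by rewrite qg /g -mulrA /q mulrA -rbE -!mulrA (mulrA b) bab.
have aS : a * S = S * a.
  rewrite /S -scalerAr -scalerAl mulr_sumr mulr_suml; congr (_ *: _).
  apply: eq_bigr => j _; rewrite /u exprZn -scalerAr -scalerAl.
  by rewrite -exprS -exprSr.
have akq : a ^+ k * q =~ a ^+ k by rewrite /q ab mulrA hk.
have aE : a - lam *: 1 = lam *: (u - 1).
  by rewrite scalerBr /u scalerA divff// scale1r.
have uS : (a - lam *: 1) * S = u ^+ k - 1.
  by rewrite aE /S -scalerAl -scalerAr scalerA divff// scale1r subrX1.
have Sq0 : (u ^+ k - 1) * (1 - q) =~ - (1 - q).
  have -> : (u ^+ k - 1) * (1 - q) = lam^-1 ^+ k *: (a ^+ k - a ^+ k * q) - (1 - q).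
    by rewrite mulrBl mul1r /u exprZn -scalerAl mulrBr mulr1.
  by rewrite akq subrr scaler0 sub0r.
have rE2 : lam *: g = r - 1 by rewrite {1}rE addrAC subrr add0r.
have ag1 : (a - lam *: 1) * g =~ q.
  have -> : (a - lam *: 1) * g = q * r - r + 1.
    by rewrite mulrBl -scalerAl mul1r rE2 opprB -[RHS]addrA [- r + 1]addrC /g mulrA.
  have -> : q * r = q + lam *: (q * g) by rewrite {1}rE mulrDr mulr1 -scalerAr.
  by rewrite qg rE2 addrA (addrAC _ (-1)) addrK subrK.
have g1a : g * (a - lam *: 1) =~ (a - lam *: 1) * g.
  by rewrite mulrBr mulrBl -scalerAr -scalerAl mulr1 mul1r ag.
have Sqa : S * (1 - q) * (a - lam *: 1) =~ (a - lam *: 1) * (S * (1 - q)).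
  pose w := S * (1 - q); rewrite -/w; have wa : w * a =~ a * w; last first.
    by rewrite mulrBr mulrBl -scalerAr -scalerAl mulr1 mul1r wa.
  have e : (1 - q) * a =~ a * (1 - q) by rewrite mulrBl mulrBr mul1r mulr1 aq.
  by rewrite /w -mulrA e !mulrA aS.
pose h := g - S * (1 - q).
have ah : (a - lam *: 1) * h =~ 1.
  by rewrite mulrBr ag1 mulrA uS Sq0 opprK addrCA subrr addr0.
exists h; split=> //.
  by rewrite -[X in _ =~ X]ah /h mulrBl [in X in _ =~ X]mulrBr g1a Sqa.
(* By the power rule, [(j + 1) tau a (a ^+ j * q)] is [tau (a ^+ j.+1) q], which vanishes as [q] is
   idempotent; the characteristic is 0. *)
have aSq j : tau a (a ^+ j * q) = 0.
  have := @tauX a q j aq; rewrite (tauN (qa j.+1)).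
  rewrite tau_idem ?oppr0//; last by symmetry; exact: qa.
  by move/esym/eqP; rewrite mulf_eq0 pnatr_eq0 => /eqP.
have caq j : a * (a ^+ j * q) =~ a ^+ j * q * a.
  by rewrite mulrA -exprS -mulrA -aq mulrA -exprSr.
have cuq j : a * (u ^+ j * q) =~ u ^+ j * q * a.
  by rewrite /u exprZn -!(scalerAl, scalerAr) caq.
have tauSq : tau a (S * q) = 0.
  rewrite /S -scalerAl mulr_suml.
  have sumc (l : nat) : a * (\sum_(j < l) u ^+ j * q) =~ (\sum_(j < l) u ^+ j * q) * a.
    elim: l => [|l IHl]; first by rewrite big_ord0 mulr0 mul0r.
    rewrite big_ord_recr /= mulrDr mulrDl IHl.
    by rewrite cuq.
  rewrite tauZr//; apply/eqP; rewrite mulf_eq0; apply/orP; right; apply/eqP.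
  elim: (k) => [|l IHl]; first by rewrite big_ord0 /tau mulr0 mul0r subrr alg_trace0.
  rewrite big_ord_recr /= tauDr; [|exact: sumc|exact: cuq].
  by rewrite IHl add0r /u exprZn -scalerAl tauZr// aSq mulr0.
have caSq : a * (S * q) =~ S * q * a by rewrite mulrA aS -(mulrA S a) aq mulrA.
have caS1q : a * (S * (1 - q)) =~ S * (1 - q) * a.
  by rewrite mulrBr mulr1 mulrBr mulrBl aS caSq.
have tauS : tau a (S * (1 - q)) = 0.
  rewrite mulrBr mulr1 tauDr; last 2 first.
  - by rewrite aS.
  - by rewrite mulrN mulNr caSq.
  rewrite -[- (S * q)]scaleN1r (tauZr _ caSq) tauSq mulr0 addr0.
  by rewrite /tau aS subrr alg_trace0.
have bg : b * g = g * b by rewrite /g -[in RHS]mulrA rbE.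
have gE : g = b + lam *: (b * g).
  by rewrite {1}/g rE mulrDr mulr1 -scalerAr.
(* The cyclic identity for [(a * b, g)] gives [0 = tau a (b * g) + tau b (g * a)]. Here [g a] is
   congruent to [q + lam g]; the first term contributes 0 by idempotency, the second because [b] and
   [g] commute exactly. *)
have tau_abg : tau a (b * g) = 0.
  have : tau (a * b) g = tau a (b * g) + tau b (g * a).
    by apply: tauM => //; rewrite bg.
  rewrite -/q tau_idem//; last by symmetry.
  have ga : g * a =~ q + lam *: g.
    rewrite -ag /g mulrA -/q {1}rE mulrDr mulr1 -scalerAr.
    by rewrite qg.
  have cb : b * (q + lam *: g) =~ (q + lam *: g) * b.
    by rewrite mulrDl mulrDr bq -scalerAr -scalerAl bg.
  rewrite (@tau_congr b (g * a) (q + lam *: g))//; last by rewrite ga.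
  have cqb : q * b =~ b * q by symmetry.
  have bgc : b * g =~ g * b by rewrite bg.
  rewrite (tauDr bq); last by rewrite -scalerAr -scalerAl bg.
  rewrite (tauZr _ bgc) (tauN bq) (tau_idem qq cqb) oppr0 add0r.
  have -> : tau b g = 0 by rewrite /tau bg subrr alg_trace0.
  by rewrite mulr0 addr0 => /esym.
have cabg : a * (b * g) =~ b * g * a.
  by symmetry; apply: congr_soc_commM; symmetry.
rewrite /h tauDr//; last by rewrite mulrN mulNr caS1q.
rewrite -[- (S * (1 - q))]scaleN1r (tauZr _ caS1q) tauS mulr0 addr0.
rewrite gE tauDr//; last by rewrite -scalerAr -scalerAl cabg.
by rewrite tauZr// tau_abg mulr0 addr0.
Qed.

End Index.

(** * Roots of unity and the Gelfand-Mazur theorem *)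

Section RealSequences.
Variable R : realType.

(** The bound is one-sided, as the definition is meant for sequences of norms. *)
Definition null_seq (u : nat -> R) :=
  forall eps, 0 < eps -> exists N, forall n, (N <= n)%N -> u n < eps.

Lemma null_seq_geometric (q c : R) : 0 <= q < 1 -> null_seq (fun n => q ^+ n * c).
Proof.
move=> /andP[q0 q1] eps eps0.
have := @cvg_geometric R c q; rewrite ger0_norm// => /(_ q1) /cvgrPdist_lt /(_ _ eps0).
move=> [N _ H]; exists N => n Nn; have := H n Nn.
rewrite sub0r normrN /geometric /= mulrC; exact: le_lt_trans (ler_norm _).
Qed.

Lemma null_seq_recursion (q : R) (a b : nat -> R) : 0 <= q < 1 ->
  (forall n, a n.+1 <= q * a n + b n) -> null_seq b -> null_seq a.
Proof.
move=> q01 hab hb eps eps0; have /andP[q0 q1] := q01.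
(* With this threshold [eps / 2] is a fixed point of the recursion, so only a geometric remainder is
   left. *)
have [|N hN] := hb (eps * (1 - q) / 2); first by rewrite divr_gt0// mulr_gt0// subr_gt0.
have [|K hK] := @null_seq_geometric q (a N) q01 (eps / 2); first by rewrite divr_gt0.
have H k : a (N + k)%N <= q ^+ k * a N + eps / 2.
  elim: k => [|k IH]; first by rewrite addn0 expr0 mul1r lerDl ltW// divr_gt0.
  rewrite addnS; apply: le_trans (hab _) _.
  have h1 := hN (N + k)%N (leq_addr _ _).
  have h2 : q * a (N + k)%N <= q * (q ^+ k * a N + eps / 2) by rewrite ler_wpM2l.
  rewrite exprS; nra.
exists (N + K)%N => n Kn; have nE : n = (N + (n - N))%N.
  by rewrite subnKC// (leq_trans (leq_addr _ _) Kn).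
rewrite nE; apply: le_lt_trans (H _) _.
have := hK (n - N)%N; rewrite leq_subRL ?(leq_trans (leq_addr K _) Kn)// => /(_ Kn).
by move=> h; lra.
Qed.

Lemma null_seq_le (u v : nat -> R) (N : nat) :
  (forall n, (N <= n)%N -> u n <= v n) -> null_seq v -> null_seq u.
Proof.
move=> uv hv eps eps0; have [M hM] := hv _ eps0; exists (maxn N M) => n.
by rewrite geq_max => /andP[Nn Mn]; apply: le_lt_trans (uv _ Nn) (hM _ Mn).
Qed.

End RealSequences.

(** * Real-valued modulus and roots of unity *)

Section ComplexModulus.
Variable R : realType.
Local Notation C := (complex R).
Local Open Scope complex_scope.

Definition cmod (c : C) : R := complex.Re `|c|.

Lemma cmodE (c : C) : `|c| = (cmod c)%:C.
Proof. by rewrite RRe_real// normr_real. Qed.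

Lemma cmod_ge0 c : 0 <= cmod c.
Proof. by rewrite -ler0c -cmodE normr_ge0. Qed.

Lemma cmod_gt0 c : (0 < cmod c) = (c != 0).
Proof. by rewrite -ltcR -cmodE normr_gt0. Qed.

Lemma cmod_real (r : R) : cmod r%:C = `|r|.
Proof. by rewrite /cmod normc_def /= expr0n /= addr0 sqrtr_sqr. Qed.

Lemma cmodM c d : cmod (c * d) = cmod c * cmod d.
Proof. by apply: (@complexI R); rewrite -cmodE normrM !cmodE -rmorphM. Qed.

Lemma cmodN c : cmod (- c) = cmod c.
Proof. by rewrite /cmod normrN. Qed.

Lemma cmod_le (a b : R) : cmod (a +i* b) <= `|a| + `|b|.
Proof.
rewrite -[_ +i* _]/(a +i* b) (_ : a +i* b = a%:C + 'i * b%:C); last first.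
  by apply/eqP; rewrite eq_complex /=; apply/andP; split; apply/eqP; ring.
rewrite -lecR -cmodE; apply: le_trans (ler_normD _ _) _.
rewrite normrM !cmodE !cmod_real -rmorphM -rmorphD lecR /cmod normc_def /=.
by rewrite expr0n expr1n add0r sqrtr1 mul1r.
Qed.

Definition cis (t : R) : C := cos t +i* sin t.

Lemma cisD s t : cis (s + t) = cis s * cis t.
Proof.
apply/eqP; rewrite eq_complex /= cosD sinD eqxx /=; apply/eqP; ring.
Qed.

Lemma cis0 : cis 0 = 1.
Proof. by rewrite /cis cos0 sin0. Qed.

Lemma cmod_cis t : cmod (cis t) = 1.
Proof. by rewrite /cmod normc_def /= cos2Dsin2 sqrtr1. Qed.

Lemma cis_neq0 t : cis t != 0.
Proof. by rewrite -cmod_gt0 cmod_cis. Qed.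

Lemma cisX t n : cis t ^+ n = cis (t * n%:R).
Proof.
elim: n => [|n IH]; first by rewrite expr0 mulr0 cis0.
by rewrite exprS IH -cisD -natr1 mulrDr mulr1 addrC.
Qed.

Lemma cis_2pi : cis (2 * pi) = 1.
Proof. by rewrite /cis mulr_natl cos2pi sin2pi. Qed.

Lemma cis_neq1 t : 0 < t < 2 * pi -> cis t != 1.
Proof.
move=> /andP[t0 t2]; apply/negP; rewrite eq_complex /= => /andP[/eqP ct _].
have : 0 < sin (t / 2) by apply: sin_gt0_pi; rewrite divr_gt0//= ltr_pdivrMr// mulrC.
have := cos_mulr2n (t / 2); have -> : (t / 2) *+ 2 = t by rewrite -mulr_natr divfK.
rewrite ct; have := cos2Dsin2 (t / 2); set c := cos _; set s := sin _.
rewrite -mulr_natr => h1 h2 s0; have : s ^+ 2 = 0 by lra.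
by move/eqP; rewrite sqrf_eq0 (gt_eqF s0).
Qed.

Definition unity_root (n k : nat) : C := cis (2 * pi * k%:R / n%:R).

Lemma unity_rootE n k : unity_root n k = unity_root n 1 ^+ k.
Proof. by rewrite /unity_root cisX mulr1 mulrAC. Qed.

Lemma unity_rootX n k : (0 < n)%N -> unity_root n k ^+ n = 1.
Proof.
move=> n0; rewrite unity_rootE -exprM mulnC exprM.
by rewrite /unity_root cisX mulr1 divfK ?pnatr_eq0 -?lt0n// cis_2pi expr1n.
Qed.

Lemma unity_root_neq0 n k : unity_root n k != 0.
Proof. exact: cis_neq0. Qed.

Lemma sum_unity_root n j : (0 < j < n)%N ->
  \sum_(k < n) (unity_root n k)^-1 ^+ j = 0.
Proof.
move=> /andP[j0 jn]; have n0 : (0 < n)%N by apply: leq_trans jn.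
pose c := (unity_root n 1)^-1 ^+ j.
have c1 : c != 1.
  rewrite /c exprVn invr_eq1 /unity_root cisX mulr1; apply: cis_neq1.
  rewrite mulr_gt0 ?divr_gt0 ?mulr_gt0 ?pi_gt0 ?ltr0n//=.
  rewrite mulrAC -mulrA gtr_pMr ?mulr_gt0 ?pi_gt0//.
  by rewrite ltr_pdivrMr ?ltr0n// mul1r ltr_nat.
have E : \sum_(k < n) (unity_root n k)^-1 ^+ j = \sum_(k < n) c ^+ k.
  by apply: eq_bigr => k _; rewrite unity_rootE /c -exprVn -!exprM mulnC.
have : (c - 1) * \sum_(k < n) c ^+ k = 0.
  by rewrite -subrX1 /c -exprM mulnC exprM exprVn unity_rootX// invr1 expr1n subrr.
by rewrite E => /eqP; rewrite mulf_eq0 subr_eq0 (negPf c1) => /eqP.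
Qed.

End ComplexModulus.

(** * Norm estimates, Neumann series and limits of Riemann sums *)

Section Banach.
Variable (R : realType).
Local Notation C := (complex R).
Variable (V : completeNormedModType C) (B : banach_algebra V).
Local Open Scope complex_scope.

(* [V] viewed as a ring; carrying the proof that the unit is nonzero makes
   MathComp's (nontrivial) algebra structures available. *)
Definition alg (nz : bone B != 0) : Type := V.

Variable nz : bone B != 0.
HB.instance Definition _ := GRing.Lmodule.on (alg nz).
HB.instance Definition _ := GRing.Zmodule_isNzRing.Build (alg nz)
  (bmulA B) (bmul1l B) (bmul1r B) (bmulDl B) (fun x y z => bmulDr B x y z) nz.
HB.instance Definition _ :=
  GRing.Lmodule_isLalgebra.Build C (alg nz) (fun c x y => esym (bmulZl B c x y)).
HB.instance Definition _ :=
  GRing.Lalgebra_isAlgebra.Build C (alg nz) (fun c x y => esym (bmulZr B c x y)).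

Local Notation A := (alg nz).
Implicit Types (x y z p : A) (c : C).

Definition nrm (x : A) : R := complex.Re `|x : V|.

Lemma nrmE x : `|x : V| = (nrm x)%:C.
Proof. by rewrite RRe_real// normr_real. Qed.

Lemma nrm_ge0 x : 0 <= nrm x.
Proof. by rewrite -ler0c -nrmE normr_ge0. Qed.

Lemma nrm0 : nrm 0 = 0.
Proof. by apply: (@complexI R); rewrite -nrmE normr0. Qed.

Lemma nrm_gt0 x : (0 < nrm x) = (x != 0).
Proof. by rewrite -ltcR -nrmE normr_gt0. Qed.

Lemma nrmD x y : nrm (x + y) <= nrm x + nrm y.
Proof. by rewrite -lecR rmorphD /= -!nrmE ler_normD. Qed.

Lemma nrmN x : nrm (- x) = nrm x.
Proof. by rewrite /nrm normrN. Qed.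

Lemma nrmB x y : nrm (x - y) <= nrm x + nrm y.
Proof. by rewrite -(nrmN y) nrmD. Qed.

Lemma nrm_distC x y : nrm (x - y) = nrm (y - x).
Proof. by rewrite -nrmN opprB. Qed.

Lemma nrm_dist x y : `|nrm x - nrm y| <= nrm (x - y).
Proof.
have h1 := nrmD (x - y) y; have h2 := nrmD (y - x) x.
rewrite subrK in h1; rewrite subrK (nrm_distC y) in h2.
rewrite ler_norml; apply/andP; split; lra.
Qed.

Lemma nrmM x y : nrm (x * y) <= nrm x * nrm y.
Proof. by rewrite -lecR rmorphM /= -!nrmE bnormM. Qed.

Lemma nrmZ c x : nrm (c *: x) = cmod c * nrm x.
Proof. by apply: (@complexI R); rewrite -nrmE rmorphM /= normrZ -cmodE -nrmE. Qed.

(** The exponent is positive because the unit is not assumed to have norm 1. *)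
Lemma nrmX x n : nrm (x ^+ n.+1) <= nrm x ^+ n.+1.
Proof.
elim: n => [|n IH]; first by rewrite !expr1.
rewrite exprS (exprS (nrm x)); apply: le_trans (nrmM _ _) _.
by rewrite ler_wpM2l ?nrm_ge0.
Qed.

Lemma nrm_sum (I : Type) (s : seq I) (f : I -> A) :
  nrm (\sum_(i <- s) f i) <= \sum_(i <- s) nrm (f i).
Proof.
elim: s => [|i s IH]; first by rewrite !big_nil nrm0.
by rewrite !big_cons; apply: le_trans (nrmD _ _) _; rewrite lerD2l.
Qed.

Lemma lim_nrm (u : nat -> A) x :
  null_seq (fun n => nrm (u n - x)) -> limn (u : nat -> V) = (x : V).
Proof.
move=> hu; apply: cvg_lim; first exact: norm_hausdorff.
apply/cvgrPdist_lt => eps eps0.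
have E : eps = (complex.Re eps)%:C by rewrite RRe_real// gtr0_real.
have [|N hN] := hu (complex.Re eps); first by rewrite -ltcR -E.
exists N => // n Nn; rewrite E -[`|_|]/`|(x - u n : A) : V| nrmE ltcR nrm_distC.
exact: hN.
Qed.

Lemma nrm_complete (u : nat -> A) :
  (forall eps : R, 0 < eps -> exists N, forall m n, (N <= m)%N -> (N <= n)%N ->
     nrm (u m - u n) < eps) ->
  exists x, null_seq (fun n => nrm (u n - x)).
Proof.
move=> hu; have : cvgn (u : nat -> V).
  apply/cauchy_cvgP/cauchy_exP => eps eps0.
  have E : eps = (complex.Re eps)%:C by rewrite RRe_real// gtr0_real.
  have [|N hN] := hu (complex.Re eps); first by rewrite -ltcR -E.
  exists (u N); exists N => // n Nn; rewrite -ball_normE /ball_ /=.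
  rewrite E -[`|_|]/`|(u N - u n : A) : V| nrmE ltcR; exact: hN.
move=> /cvg_ex[x /cvgrPdist_lt hx]; exists (x : A) => eps eps0.
have [|N _ hN] := hx (eps%:C); first by rewrite ltcR.
exists N => n Nn; have := hN n Nn.
by rewrite -[`|_|]/`|((x : A) - u n : A) : V| nrmE ltcR nrm_distC.
Qed.

(** Neumann series; the bound 1/2 gives explicit geometric tails. *)
Lemma invertible_1B x : nrm x <= 2^-1 -> invertible (1 - x).
Proof.
move=> hx; pose u n : A := \sum_(k < n) x ^+ k.
have pw n : nrm (x ^+ n.+1) <= 2^-1 ^+ n.+1.
  by apply: le_trans (nrmX _ _) _; rewrite lerXn2r ?nnegrE ?nrm_ge0 ?invr_ge0.
have tail n k : nrm (u (n.+1 + k)%N - u n.+1) <= 2 * 2^-1 ^+ n.+1 - 2 * 2^-1 ^+ (n.+1 + k).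
  elim: k => [|k IH]; first by rewrite addn0 !subrr nrm0.
  rewrite addnS {1}/u big_ord_recr /= -/(u (n.+1 + k)%N) addrAC.
  apply: le_trans (nrmD _ _) _; have := pw (n + k)%N; rewrite -addSn => h.
  by rewrite [2^-1 ^+ (n.+1 + k).+1]exprS; lra.
have tail' n m : (n < m)%N -> nrm (u m - u n.+1) <= 2 * 2^-1 ^+ n.+1.
  move=> nm; have := tail n (m - n.+1)%N; rewrite subnKC// => h.
  have : 0 <= (2^-1 : R) ^+ m by rewrite exprn_ge0 ?invr_ge0.
  by move: h; lra.
have half : 0 <= (2^-1 : R) < 1 by rewrite invr_ge0 ler0n invf_lt1// ltr1n.
have [|s hs] := @nrm_complete u.
  (* The factor 4 adds up two tails, each at most [2 * 2^-1 ^+ N.+1]. *)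
  move=> eps eps0; have [|N hN] := @null_seq_geometric R _ 4 half eps; first by [].
  exists N.+1 => m n Nm Nn; rewrite -(subrK (u N.+1) (u m)) -addrA.
  apply: le_lt_trans (nrmD _ _) _; rewrite [X in _ + X]nrm_distC.
  have h1 := tail' N m Nm; have h2 := tail' N n Nn; have := hN N.+1 (leqnSn _); lra.
have bnd z (c : R) : 0 <= c -> (forall n, nrm z <= c * nrm (u n.+1 - s) + 2^-1 ^+ n.+1) -> z = 0.
  move=> c0 hz; apply/eqP; rewrite -[_ == _]negbK -nrm_gt0; apply/negP => z0.
  have c1 : 0 < 2 * (c + 1) by rewrite mulr_gt0// ltr_wpDl.
  have [|N hN] := hs (nrm z / (2 * (c + 1))); first exact: divr_gt0.
  have [|M hM] := @null_seq_geometric R _ 2 half (nrm z); first by [].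
  pose n := maxn N M; have h1 := hN n.+1 (leqW (leq_maxl _ _)).
  have h2 := hM n.+1 (leqW (leq_maxr _ _)); have h3 := hz n.
  rewrite ltr_pdivlMr// in h1; have h4 := nrm_ge0 (u n.+1 - s); nra.
have uxl n : (1 - x) * u n = 1 - x ^+ n.
  by rewrite -opprB mulNr -subrX1 opprB.
have uxr n : u n * (1 - x) = 1 - x ^+ n.
  rewrite -uxl mulrBr mulrBl mulr1 mul1r /u mulr_sumr mulr_suml; congr (_ - _).
  by apply: eq_bigr => k _; rewrite -exprS -exprSr.
exists s; split; apply/eqP; rewrite -subr_eq0; apply/eqP.
  apply: (bnd _ (nrm (1 - x))); rewrite ?nrm_ge0// => n.
  have -> : (1 - x) * s - 1 = - ((1 - x) * (u n.+1 - s)) - x ^+ n.+1.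
    by rewrite mulrBr uxl opprB -addrA -opprD subrK.
  apply: le_trans (nrmB _ _) _; rewrite nrmN; apply: lerD (pw n); exact: nrmM.
apply: (bnd _ (nrm (1 - x))); rewrite ?nrm_ge0// => n.
have -> : s * (1 - x) - 1 = - ((u n.+1 - s) * (1 - x)) - x ^+ n.+1.
  by rewrite mulrBl uxr opprB -addrA -opprD subrK.
apply: le_trans (nrmB _ _) _; rewrite nrmN; apply: lerD (pw n).
by rewrite mulrC; exact: nrmM.
Qed.

(* The resolvents [y k] solve [y = p + w_k^-1 z y]; averaging the finite
   geometric expansions over the roots of unity keeps only the constant term. *)
Lemma unity_root_average n p z (y : nat -> A) : (0 < n)%N ->
  (forall k, (k < n)%N -> y k = p + (unity_root R n k)^-1 *: (z * y k)) ->
  let S := n%:R^-1 *: \sum_(k < n) y k in S - z ^+ n * S = p.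
Proof.
move=> n0 hy S.
have geo k m : (k < n)%N -> y k = \sum_(j < m) (unity_root R n k)^-1 ^+ j *: (z ^+ j * p)
    + (unity_root R n k)^-1 ^+ m *: (z ^+ m * y k).
  move=> kn; elim: m => [|m IH]; first by rewrite big_ord0 add0r !expr0 mul1r scale1r.
  rewrite big_ord_recr /= {1}IH {1}(hy k kn) mulrDr scalerDr addrA.
  by rewrite -scalerAr scalerA -exprSr mulrA -exprSr.
have E : \sum_(k < n) y k = n%:R *: p + z ^+ n * \sum_(k < n) y k.
  rewrite mulr_sumr -[LHS]/(\sum_(k < n) y k).
  have {1}-> : \sum_(k < n) y k = \sum_(k < n) (\sum_(j < n)
     (unity_root R n k)^-1 ^+ j *: (z ^+ j * p) + z ^+ n * y k).
    apply: eq_bigr => k _; rewrite {1}(geo k n)//.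
    by rewrite exprVn unity_rootX// invr1 scale1r.
  rewrite big_split /=; congr (_ + _); rewrite exchange_big /=.
  case: n n0 {hy S geo} => // n _; rewrite big_ord_recl /= [X in _ + X]big1 ?addr0.
    rewrite (eq_bigr (fun=> p)); last by move=> i _; rewrite /= !expr0 mul1r scale1r.
    by rewrite sumr_const card_ord scaler_nat.
  move=> j _; rewrite -scaler_suml sum_unity_root ?scale0r//=.
  by rewrite /bump /= add1n ltnS ltn_ord.
rewrite /S -scalerAr -scalerBr {1}E addrK scalerA mulVf ?scale1r//.
by rewrite pnatr_eq0 -lt0n.
Qed.

(** [t] is a backward orbit of [y / rho], annihilated by a polynomial in [y] whose roots have
    modulus above [rho]. For a root [d], [(y - d) t] is an orbit of the same kind with one root
    fewer, and [d t(n+1) = rho t(n) - (y - d) t(n+1)] contracts by [rho / |d|]. *)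
Lemma decay y (rho : R) (ds : seq C) (t : nat -> A) : 0 < rho ->
  (forall d, d \in ds -> rho < cmod d) ->
  (forall n, rho%:C *: t n = y * t n.+1) ->
  (forall n, horner_alg y (vanishing_poly ds) * t n = 0) ->
  null_seq (fun n => nrm (t n)).
Proof.
move=> rho0; elim: ds t => [|d ds IH] t hds ht h0.
  move=> eps eps0; exists 0%N => n _; have := h0 n.
  by rewrite /vanishing_poly big_nil rmorph1 mul1r => ->; rewrite nrm0.
have hd : rho < cmod d by apply: hds; rewrite mem_head.
have d0 : 0 < cmod d by apply: lt_trans hd.
pose t' n := horner_alg y ('X - d%:P) * t n.
have ht' : null_seq (fun n => nrm (t' n)).
  apply: IH => [c cds|n|n]; first by apply: hds; rewrite inE cds orbT.
    rewrite /t' scalerAr ht !mulrA; congr (_ * _).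
    by rewrite -{2 3}(horner_algX y) horner_alg_comm.
  by rewrite /t' mulrA -rmorphM mulrC; have := h0 n; rewrite /vanishing_poly big_cons.
have step n : d *: t n.+1 = rho%:C *: t n - t' n.+1.
  by rewrite /t' ht horner_alg_XsubC mulrBl -scalerAl mul1r subKr.
apply: (@null_seq_recursion R (rho / cmod d) _ (fun n => nrm (t' n.+1) / cmod d)).
- by rewrite divr_ge0 ?(ltW rho0) ?(ltW d0)//= ltr_pdivrMr// mul1r.
- move=> n; have := nrmZ d (t n.+1); rewrite step => H.
  rewrite -(ler_pM2l d0) -H.
  have -> : cmod d * (rho / cmod d * nrm (t n) + nrm (t' n.+1) / cmod d) =
    rho * nrm (t n) + nrm (t' n.+1) by field; rewrite gt_eqF.
  by apply: le_trans (nrmB _ _) _; rewrite nrmZ cmod_real gtr0_norm.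
- move=> eps eps0; have [|N hN] := ht' (eps * cmod d); first exact: mulr_gt0.
  by exists N => n Nn; rewrite ltr_pdivrMr//; apply: hN; apply: leqW.
Qed.

(** Since [p z ^+ M = 0], eventually [p s_n = p]. On the complement [t_n] inverts [z ^+ n], whence
    [s_n - p = t_n (s_n - p) - t_n]; once [t_n] has norm below 1/2 this bounds [s_n - p] by twice
    the norm of [t_n]. *)
Lemma spectral_projection_limit p z (s t : nat -> A) M :
  (forall n, (0 < n)%N -> s n - z ^+ n * s n = 1) ->
  p * z ^+ M = 0 -> t 0%N = 1 - p -> (forall n, t n.+1 * z = t n) ->
  (forall n, t n * (1 - p) = t n) ->
  null_seq (fun n => nrm (t n)) -> null_seq (fun n => nrm (s n - p)).
Proof.
move=> hs pz t0 tz tq ht.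
have tzn n : t n * z ^+ n = 1 - p.
  by elim: n => [|n IH]; rewrite ?expr0 ?mulr1// exprS mulrA tz.
have psn n : (maxn 1 M <= n)%N -> p * s n = p.
  rewrite geq_max => /andP[n0 Mn]; have := congr1 (fun t => p * t) (hs n n0).
  rewrite mulr1 mulrBr mulrA -(subnKC Mn) exprD mulrA pz !mul0r subr0.
  by rewrite subnKC.
have key n : (maxn 1 M <= n)%N -> s n - p = t n * (s n - p) - t n.
  move=> nM; have n0 : (0 < n)%N by move: nM; rewrite geq_max => /andP[].
  have sE : s n - p = (1 - p) * s n by rewrite mulrBl mul1r psn.
  have H := congr1 (fun x => t n * x) (hs n n0).
  rewrite mulr1 mulrBr mulrA tzn in H.
  by rewrite sE mulrA tq -{2}H subKr.
have [|N hN] := ht 2^-1; first by rewrite invr_gt0 ltr0n.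
apply: (@null_seq_le _ _ (fun n => 2 * nrm (t n)) (maxn N (maxn 1 M))); last first.
  move=> eps eps0; have [|N' hN'] := ht (eps / 2); first exact: divr_gt0.
  by exists N' => n Nn; have := hN' n Nn; lra.
move=> n; rewrite geq_max => /andP[Nn nM].
have h1 := hN n Nn; have h2 := nrmB (t n * (s n - p)) (t n).
rewrite -(key n nM) in h2; have h3 := nrmM (t n) (s n - p).
have h4 := nrm_ge0 (s n - p); have h5 := nrm_ge0 (t n); nra.
Qed.

(** * Gelfand-Mazur in a corner: a resolvent defined on the whole plane is impossible *)

Section GelfandMazur.
Variables (p x : A).
Hypotheses (pp : p * p = p) (p0 : p <> 0) (px : p * x = x) (xp : x * p = x).
Variable res : C -> A.
Hypotheses (pres : forall c, p * res c = res c).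
Hypotheses (resl : forall c, res c * (c *: p - x) = p).
Hypotheses (resr : forall c, (c *: p - x) * res c = p).
Local Notation N c := (nrm (res c)).

Lemma resolvent_identity c d : res c - res d = (d - c) *: (res c * res d).
Proof.
have E : res c * p = res c by rewrite -{1}(resr c) mulrA resl pres.
have -> : (d - c) *: (res c * res d) =
   res c * ((d *: p - x) * res d) - (res c * (c *: p - x)) * res d.
  rewrite -mulrA -mulrBr -mulrBl opprB addrA subrK -scalerBl -scalerAl pres.
  by rewrite -scalerAr.
by rewrite resr resl pres E.
Qed.

Lemma resolvent_bound c d : cmod (d - c) * N c <= 2^-1 -> N d <= 2 * N c.
Proof.
move=> H; have h := nrmZ (d - c) (res c * res d); rewrite -resolvent_identity in h.
have h1 := nrmM (res c) (res d); have h2 := cmod_ge0 (d - c).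
have h3 : N d <= N c + nrm (res c - res d).
  by rewrite nrm_distC -{1}(subrK (res c) (res d)) addrC; exact: nrmD.
have h4 : nrm (res c - res d) <= 2^-1 * N d.
  rewrite h; apply: le_trans (_ : cmod (d - c) * (N c * N d) <= _).
    by rewrite ler_wpM2l.
  by rewrite mulrA ler_wpM2r// nrm_ge0.
lra.
Qed.

Lemma resolvent_circle_bound (rho : R) : exists2 M, 0 < M &
  forall t, 0 <= t <= 2 * pi -> N (rho%:C * cis t) <= M.
Proof.
pose f t := N (rho%:C * cis t).
have cf : continuous f.
  move=> t0; apply/cvgrPdist_lt => eps eps0.
  pose m := f t0; have m0 : 0 <= m by apply: nrm_ge0.
  pose g t := `|rho| * (`|cos t0 - cos t| + `|sin t0 - sin t|).
  have hg t : cmod (rho%:C * cis t0 - rho%:C * cis t) <= g t.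
    rewrite -mulrBr cmodM cmod_real ler_wpM2l//; exact: cmod_le.
  (* The first bound makes [resolvent_bound] applicable, giving [f t <= 2 * m]; the second keeps the
     variation [del * (m * (2 * m))] below [eps]. *)
  pose del := Num.min (2^-1 / (m + 1)) (eps / (2 * (m ^+ 2 + 1))).
  have del0 : 0 < del.
    by rewrite lt_min !divr_gt0 ?mulr_gt0 ?ltr_wpDl ?sqr_ge0.
  have nr : 0 < del / (2 * (`|rho| + 1)) by rewrite divr_gt0// mulr_gt0// ltr_wpDl.
  near=> t.
  have h1 : `|cos t0 - cos t| < del / (2 * (`|rho| + 1)).
    by near: t; have /cvgrPdist_lt := @continuous_cos R t0; apply.
  have h2 : `|sin t0 - sin t| < del / (2 * (`|rho| + 1)).
    by near: t; have /cvgrPdist_lt := @continuous_sin R t0; apply.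
  have h3 : g t <= del.
    rewrite /g; have r1 : 0 < `|rho| + 1 by rewrite ltr_wpDl.
    apply: le_trans (_ : (`|rho| + 1) * (del / (2 * (`|rho| + 1)) + del / (2 * (`|rho| + 1))) <= _).
      by apply: ler_pM => //; [rewrite lerDl|rewrite lerD// ltW].
    by rewrite le_eqVlt; apply/orP; left; apply/eqP; field; rewrite gt_eqF.
  have h4 : cmod (rho%:C * cis t0 - rho%:C * cis t) <= del by apply: le_trans (hg t) h3.
  have h5 : del * (m + 1) <= 2^-1.
    rewrite -ler_pdivlMr; last by rewrite ltr_wpDl.
    by rewrite /del ge_min lexx.
  have h6 : del * (2 * (m ^+ 2 + 1)) <= eps.
    rewrite -ler_pdivlMr; last by rewrite mulr_gt0// ltr_wpDl// sqr_ge0.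
    by rewrite /del ge_min lexx orbT.
  have h7 : f t <= 2 * m.
    apply: resolvent_bound; rewrite -cmodN opprB.
    apply: le_trans (_ : del * (m + 1) <= _) => //.
    by apply: ler_pM; rewrite ?cmod_ge0 ?nrm_ge0// lerDl.
  have h8 : `|f t0 - f t| <= del * (m * (2 * m)).
    apply: le_trans (_ : nrm (res (rho%:C * cis t0) - res (rho%:C * cis t)) <= _).
      exact: nrm_dist.
    rewrite resolvent_identity nrmZ -cmodN opprB; apply: ler_pM => //; rewrite ?cmod_ge0 ?nrm_ge0//.
    apply: le_trans (nrmM _ _) _; apply: ler_pM; rewrite ?nrm_ge0//.
  apply: le_lt_trans h8 _; nra.
have [|c _ hc] := @EVT_max R f 0 (2 * pi) _ (continuous_subspaceT cf).
  by rewrite mulr_ge0// pi_ge0.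
exists (f c + 1); first by rewrite ltr_wpDl// nrm_ge0.
move=> t ht; apply: le_trans (_ : f c <= _); last by rewrite lerDl.
by apply: hc; rewrite in_itv.
Unshelve. all: by end_near.
Qed.

(** Riemann sum of the resolvent integral over the circle of radius [r] about 0. *)
Definition res_average (r : R) n : A :=
  n%:R^-1 *: \sum_(k < n) ((r%:C * unity_root R n k) *: res (r%:C * unity_root R n k)).

Lemma res_averageE (r : R) n : 0 < r -> (0 < n)%N ->
  res_average r n - (r%:C^-1 *: x) ^+ n * res_average r n = p.
Proof.
move=> r0 n0; apply: (unity_root_average n0
  (y := fun k => (r%:C * unity_root R n k) *: res (r%:C * unity_root R n k))) => k kn.
set w := unity_root R n k; have w0 : w != 0 := unity_root_neq0 R n k.
have rC : r%:C != 0 by rewrite -cmod_gt0 cmod_real normr_gt0 gt_eqF.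
rewrite -[X in X + _](resr (r%:C * w)) mulrBl -scalerAl pres.
rewrite -scalerAl -scalerAr !scalerA (_ : _ * _ * _ = 1) ?scale1r ?subrK//.
by rewrite mulrA mulrC mulrA; field; rewrite rC w0.
Qed.

Definition growth_bound (r : R) :=
  0 < r /\ exists M, forall n, (M <= n)%N -> nrm (x ^+ n) <= r ^+ n.

Lemma nrm_scaled_pow (r : R) n : 0 < r ->
  nrm ((r%:C^-1 *: x) ^+ n) = nrm (x ^+ n) / r ^+ n.
Proof.
move=> r0; rewrite exprZn nrmZ -rmorphV ?unitfE ?gt_eqF// -rmorphXn cmod_real.
by rewrite gtr0_norm ?exprn_gt0 ?invr_gt0// exprVn mulrC.
Qed.

Lemma growth_bound_average (r s : R) : growth_bound r -> r < s ->
  exists M, forall n, (M <= n)%N -> nrm (res_average s n - p) <= 4^-1.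
Proof.
move=> [r0 [M hM]] rs; have s0 : 0 < s by apply: lt_trans rs.
(* If [z] has norm at most 1/5, then [S - p = z (S - p) + z] gives the bound (1/5) / (1 - 1/5) =
   1/4. *)
have [||K hK] := @null_seq_geometric R (r / s) 1 _ (5^-1).
  by rewrite divr_ge0 ?ltW//= ltr_pdivrMr// mul1r.
  by rewrite invr_gt0.
exists (maxn 1 (maxn M K)) => n; rewrite !geq_max => /and3P[n0 Mn Kn].
have := res_averageE s0 n0; set S := res_average s n; set z := _ ^+ n => H.
have hz : nrm z <= 5^-1.
  rewrite /z nrm_scaled_pow// ltW//; apply: le_lt_trans (hK n Kn).
  by rewrite mulr1 expr_div_n ler_pM2r ?invr_gt0 ?exprn_gt0// hM.
have zp : z * p = z by rewrite /z; case: (n) n0 => // k _; rewrite exprSr -mulrA -scalerAl xp.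
have E : S - p = z * (S - p) + z by rewrite mulrBr zp subrK -{1}H subKr.
have h1 := nrmD (z * (S - p)) z; rewrite -E in h1.
have h2 := nrmM z (S - p); have h3 := nrm_ge0 (S - p); have h4 := nrm_ge0 z; nra.
Qed.

(** Converse passage: [z = (S - p) - z (S - p)] with [S - p] of norm at most 1/2 forces [z] to have
    norm at most 1. *)
Lemma average_growth_bound (r : R) : 0 < r ->
  (exists M, forall n, (M <= n)%N -> nrm (res_average r n - p) <= 2^-1) ->
  growth_bound r.
Proof.
move=> r0 [M hM]; split=> //; exists (maxn 1 M) => n; rewrite geq_max => /andP[n0 Mn].
have := res_averageE r0 n0; have := hM n Mn.
set S := res_average r n => h0; have := nrm_scaled_pow n r0; set z := _ ^+ n => hz H.
have zp : z * p = z by rewrite /z; case: (n) n0 => // k _; rewrite exprSr -mulrA -scalerAl xp.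
have E : z = (S - p) - z * (S - p) by rewrite mulrBr zp -{1}H !subKr.
have h1 := nrmB (S - p) (z * (S - p)); rewrite -E in h1.
have h2 := nrmM z (S - p); have h3 := nrm_ge0 (S - p); have h4 := nrm_ge0 z.
have : nrm z <= 1 by nra.
by rewrite hz ler_pdivrMr ?exprn_gt0// mul1r.
Qed.

(** As [c res(c) = p + x res(c)], two summands differ by [x] times a difference of resolvents, which
    the resolvent identity controls. *)
Lemma res_average_dist (a b M del : R) n : (0 < n)%N -> 0 <= M -> 0 <= del ->
  (forall t, 0 <= t <= 2 * pi -> N (a%:C * cis t) <= M /\ N (b%:C * cis t) <= M) ->
  `|b - a| <= del ->
  nrm (res_average a n - res_average b n) <= nrm x * (del * M ^+ 2).
Proof.
move=> n0 M0 del0 hM hab; rewrite /res_average -scalerBr -sumrB nrmZ.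
have -> : cmod (n%:R^-1 : C) = n%:R^-1.
  by rewrite -(rmorph_nat (real_complex R)) -fmorphV cmod_real ger0_norm// invr_ge0.
rewrite mulrC ler_pdivrMr ?ltr0n//.
apply: le_trans (nrm_sum _ _) _; rewrite mulr_natr -[X in _ *+ X]card_ord -sumr_const.
apply: ler_sum => k _; set w := unity_root R n k.
have [|ha hb] := hM (2 * pi * k%:R / n%:R).
  rewrite divr_ge0 ?mulr_ge0 ?pi_ge0//= ler_pdivrMr ?ltr0n//.
  by rewrite ler_wpM2l ?mulr_ge0 ?pi_ge0// ler_nat ltnW.
rewrite -/(unity_root R n k) -/w in ha hb.
have E c : c *: res c = p + x * res c.
  by rewrite -[X in X + _](resr c) mulrBl -scalerAl pres subrK.
rewrite !E opprD addrACA subrr add0r -mulrBr.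
apply: le_trans (nrmM _ _) _; rewrite ler_wpM2l ?nrm_ge0//.
rewrite resolvent_identity nrmZ -mulrBl cmodM cmod_cis mulr1 -rmorphB cmod_real.
apply: ler_pM => //; first exact: nrm_ge0.
by apply: le_trans (nrmM _ _) _; rewrite expr2; apply: ler_pM; rewrite ?nrm_ge0.
Qed.

(* The infimum [rho] of the growth bounds is the spectral radius: comparing the
   averages on the circles of radii [rho - del] and [rho + del] would make
   [rho - del] a growth bound as well. *)
Lemma no_global_resolvent : False.
Proof.
have p1 : 1 <= nrm p.
  have h := nrmM p p; rewrite pp in h.
  have : 0 < nrm p by rewrite nrm_gt0; apply/eqP.
  by move=> h'; rewrite -(ler_pM2l h') mulr1.
have gb1 : growth_bound (nrm x + 1).
  have h0 := nrm_ge0 x; split; first by rewrite ltr_wpDl.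
  exists 1%N => -[//|n] _; apply: le_trans (nrmX _ _) _.
  by rewrite lerXn2r ?nnegrE ?addr_ge0// lerDl.
(* [y] inverts [x] in the corner, so [x ^+ n * y ^+ n = p] stays of norm at least 1; this keeps all
   growth bounds above [(nrm y)^-1] and makes [rho] positive. *)
pose y := - res 0.
have xy : x * y = p by rewrite mulrN -mulNr -[RHS](resr 0) scale0r sub0r.
have xyn n : (0 < n)%N -> x ^+ n * y ^+ n = p.
  case: n => // n _; elim: n => [|n IH]; first by rewrite !expr1.
  rewrite exprSr (exprS y) mulrA -(mulrA (_ ^+ _)) xy.
  by rewrite (_ : _ * p = x ^+ n.+1) ?IH// exprSr -mulrA xp.
have y0 : 0 < nrm y.
  rewrite nrm_gt0; apply/eqP => y0; apply: p0; by rewrite -xy y0 mulr0.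
have lbd r : growth_bound r -> (nrm y)^-1 <= r.
  move=> [r0 [M hM]]; rewrite -[X in X <= _]mul1r ler_pdivrMr//.
  rewrite leNgt; apply/negP => ry.
  have [||K hK] := @null_seq_geometric R (r * nrm y) 1 _ 1; rewrite ?ltr01//.
    by rewrite ry mulr_ge0 ?nrm_ge0// ltW.
  pose n := (maxn M K).+1; have := hK n; rewrite mulr1 ltNge.
  rewrite (_ : (K <= n)%N); last by rewrite ltnW// ltnS leq_maxr.
  move=> /(_ isT)/negP; apply; apply: le_trans p1 _.
  rewrite -(xyn n)// exprMn; apply: le_trans (nrmM _ _) _.
  apply: ler_pM; rewrite ?nrm_ge0//; last exact: nrmX.
  by apply: hM; rewrite ltnW// ltnS leq_maxl.
pose E := [set r | growth_bound r]; have hE : has_inf E.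
  by split; [exists (nrm x + 1)|exists (nrm y)^-1 => r /lbd].
pose rho := inf E; have rho0 : 0 < rho.
  apply: lt_le_trans (_ : (nrm y)^-1 <= _); first by rewrite invr_gt0.
  by apply: lb_le_inf => //; exact: hE.1.
have [M M0 hM] := resolvent_circle_bound rho.
have x0 := nrm_ge0 x.
pose K := 4 * 8 * (nrm x + 1) * M ^+ 2.
have K0 : 0 < K by rewrite !mulr_gt0// ?ltr_wpDl// exprn_gt0.
(* These bounds respectively keep [rho - del] positive, keep the resolvent below [2 * M] on both
   nearby circles, and keep the two averages within 1/4 of each other. *)
pose del := Num.min (rho / 2) (Num.min (2^-1 / M) (K^-1)).
have del0 : 0 < del by rewrite !lt_min !divr_gt0// ?invr_gt0.
have d1 : del <= rho / 2 by rewrite /del ge_min lexx.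
have d2 : del * M <= 2^-1 by rewrite -ler_pdivlMr// /del !ge_min lexx !orbT.
have d3 : del * K <= 1 by rewrite -ler_pdivlMr// div1r /del !ge_min lexx !orbT.
have near_bound (s : R) t : 0 <= t <= 2 * pi -> `|rho - s| <= del -> N (s%:C * cis t) <= 2 * M.
  move=> ht hs; have hb := hM t ht.
  apply: le_trans (_ : 2 * N (rho%:C * cis t) <= _); last by rewrite ler_pM2l.
  apply: resolvent_bound; rewrite -mulrBl cmodM cmod_cis mulr1 -rmorphB cmod_real.
  apply: le_trans d2; apply: ler_pM; rewrite ?nrm_ge0//.
  by rewrite -normrN opprB.
have [r Er rr] := inf_adherent del0 hE; rewrite -/rho in rr.
have [M1 hM1] := growth_bound_average Er rr.
have : growth_bound (rho - del).
  apply: average_growth_bound; first lra.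
  exists (maxn 1 M1) => n; rewrite geq_max => /andP[n0 Mn].
  have h1 := hM1 n Mn.
  have h2 : nrm (res_average (rho - del) n - res_average (rho + del) n) <=
     nrm x * (2 * del * (2 * M) ^+ 2).
    apply: res_average_dist => //; [lra|lra| |].
      move=> t ht; split; apply: near_bound => //.
        by rewrite opprB addrCA subrr addr0 gtr0_norm.
      by rewrite opprD addrA subrr sub0r normrN gtr0_norm.
    rewrite ler_norml; apply/andP; split; lra.
  have h3 : nrm x * (2 * del * (2 * M) ^+ 2) <= 4^-1.
    have : (nrm x) * (del * M ^+ 2 * 32) <= (nrm x + 1) * (del * M ^+ 2 * 32).
      by rewrite ler_wpM2r ?lerDl// !mulr_ge0 ?sqr_ge0// ltW.
    move: d3; rewrite /K expr2 => d3 h; rewrite expr2; nra.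
  have h4 := nrmD (res_average (rho - del) n - res_average (rho + del) n)
     (res_average (rho + del) n - p).
  by rewrite addrA subrK in h4; lra.
move=> /(ge_inf hE.2); rewrite -/rho; lra.
Qed.

End GelfandMazur.

(** If [p x p] is not a scalar multiple of [p], every [c p - p x p] is nonzero, hence left
    invertible in the corner. Its left inverse is again left invertible, so the inverse is two-sided
    and gives a global resolvent. *)
Lemma gelfand_mazur p : p * p = p -> p <> 0 ->
  (forall x, p * x * p <> 0 -> exists y, (p * y * p) * (p * x * p) = p) ->
  forall x, exists c, p * x * p = c *: p.
Proof.
move=> pp p0 hdiv x0; apply: contrapT => /forallNP hx.
pose x := p * x0 * p.
have px : p * x = x by rewrite /x !mulrA pp.
have xp : x * p = x by rewrite /x -!mulrA pp.
have hl c : exists y, p * y * p * (c *: p - x) = p.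
  have E : p * (c *: 1 - x0) * p = c *: p - x.
    by rewrite mulrBr mulrBl -scalerAr mulr1 -scalerAl pp.
  rewrite -E; apply: hdiv; rewrite E => /eqP; rewrite subr_eq0 => /eqP H.
  by apply: (hx c); rewrite -/x -H.
have [res0 hres0] := choice hl; pose res c := p * res0 c * p.
have pres c : p * res c = res c by rewrite /res !mulrA pp.
have resp c : res c * p = res c by rewrite /res -!mulrA pp.
have resr c : (c *: p - x) * res c = p.
  have [|y hy] := hdiv (res c).
    rewrite pres resp => H; apply: p0; rewrite -(hres0 c) -/(res c) H mul0r//.
  rewrite pres resp in hy.
  have yE : p * y * p = c *: p - x.
    have := congr1 (fun t => t * (c *: p - x)) hy; rewrite -(mulrA (p * y * p)).
    by rewrite [res c * _](hres0 c) mulrBr -scalerAr px pp -(mulrA (p * y)) pp.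
  by rewrite -yE.
exact: (@no_global_resolvent p x pp p0 xp res pres hres0 resr).
Qed.

End Banach.

(** * The socle, Riesz projections and the index *)

Section Socle.
Variables (R : realType).
Local Notation C := (complex R).
Variables (V : completeNormedModType C) (B : banach_algebra V) (nz : bone B != 0).
Local Notation A := (alg nz).
Local Open Scope complex_scope.
Hypothesis ss : semisimple B.
Implicit Types (x y z p u : A).

(** If [x A x = 0], then [y x] squares to 0 and [1 + y x] inverts [1 - y x] for every [y]. *)
Lemma semisimple_semiprime : semiprime A.
Proof.
move=> x hx; apply: ss => y; exists (1 + (y : A) * x : A).
have yxyx : (y : A) * x * ((y : A) * x) = 0 by rewrite -mulrA (mulrA x) hx mulr0.
split.
  rewrite -[LHS]/((1 - (y : A) * x) * (1 + (y : A) * x)) mulrBl mul1r mulrDr mulr1 yxyx.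
  by rewrite addr0 addrK.
rewrite -[LHS]/((1 + (y : A) * x) * (1 - (y : A) * x)) mulrBr mulr1 mulrDl mul1r yxyx.
by rewrite addr0 addrK.
Qed.
Let sp := semisimple_semiprime.

(** Brauer's lemma. For [u] in [L] with [L u] nonzero, minimality gives [L u = L]; an element [p] of
    [L] with [p u = u] is the required idempotent, and the same surjectivity gives left inverses in
    [p A p]. *)
Lemma minimal_left_ideal_idempotent (L : set V) : minimal_left_ideal B L ->
  exists p : A, [/\ p * p = p, p <> 0, L p,
    (forall u : A, L u -> u * p = u) &
    (forall x : A, p * x * p <> 0 -> exists y, p * y * p * (p * x * p) = p)].
Proof.
move=> [[L0 LB LM] Ln0 Lmin].
have LMA (a u : A) : L u -> L (a * u) by apply: LM.
have LBA (v u : A) : L v -> L u -> L (v - u) by apply: LB.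
have minE (M : set V) (v : A) : left_ideal B M -> M `<=` L -> M v -> v <> 0 -> M = L.
  by move=> hM ML Mv v0; case: (Lmin M hM ML) => // M0; move: Mv; rewrite M0.
have [w Lw w0] : exists2 w : A, L w & w <> 0.
  apply: contrapT => H; apply: Ln0; apply/seteqP; split=> [v Lv|v ->//].
  by apply: contrapT => v0; apply: H; exists v.
have [v [u [Lv Lu vu0]]] : exists v u : A, [/\ L v, L u & v * u <> 0].
  have [y hy] : exists y, w * y * w <> 0 by apply/existsNP => H; apply: w0; apply: sp.
  by exists w, (y * w); rewrite mulrA; split=> //; apply: LMA.
have imE (t : A) : L t -> (exists2 v : A, L v & v * t <> 0) ->
    forall s : A, L s -> exists2 v : A, L v & s = v * t.
  move=> Lt [v' Lv' vt0]; pose M := [set z : V | exists2 v : A, L v & z = v * t].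
  have ME : M = L.
    apply: (minE M (v' * t)) => //; last by exists v'.
    - split; first by exists 0 => //; rewrite mul0r.
        move=> _ _ [a La ->] [b Lb ->]; exists (a - b); first exact: LBA.
        by rewrite mulrBl.
      move=> a _ [b Lb ->]; exists ((a : A) * b); first exact: LMA.
      by rewrite -[LHS]/((a : A) * (b * t)) mulrA.
    - by move=> _ [b Lb ->]; apply: LMA.
  by move=> s Ls; have : M s by rewrite ME.
have [p Lp pE] := imE u Lu (ex_intro2 _ _ v Lv vu0) u Lu.
(* Right multiplication by [u] is injective on [L], its kernel being a proper left ideal inside [L];
   it kills [p * p - p]. *)
pose N := [set z : V | L z /\ (z : A) * u = 0].
have N0 : N = [set 0].
  case: (Lmin N) => //.
  - split; first by split=> //; rewrite mul0r.
      move=> a b [La au] [Lb bu]; split; first exact: LB.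
      by rewrite -[LHS]/(((a : A) - (b : A)) * u) mulrBl au bu subrr.
    move=> a b [Lb bu]; split; first exact: LM.
    by rewrite -[LHS]/((a : A) * (b : A) * u) -mulrA bu mulr0.
  - by move=> z [].
  - move=> NL; have : N v by rewrite NL.
    by case.
have pp : p * p = p.
  apply/eqP; rewrite -subr_eq0; apply/eqP.
  have : N (p * p - p) by split; [apply: LBA => //; exact: LMA|rewrite mulrBl -mulrA -pE -pE subrr].
  by rewrite N0.
have p0 : p <> 0 by move=> H; apply: vu0; rewrite pE H mul0r mulr0.
have Lpp : exists2 v : A, L v & v * p <> 0 by exists p; rewrite // pp.
exists p; split=> //.
  by move=> t Lt; have [s Ls ->] := imE p Lp Lpp t Lt; rewrite -mulrA pp.
move=> x hx; have [||y Ly py] := imE (p * x * p) _ _ p Lp.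
- exact: LMA.
- by exists p => //; rewrite !mulrA pp.
exists y; have yp : y * p = y.
  by have [s Ls ->] := imE p Lp Lpp y Ly; rewrite -mulrA pp.
by rewrite -(mulrA p y) yp -(mulrA p y) -py pp.
Qed.

Lemma minimal_left_ideal_rank_one (L : set V) u :
  minimal_left_ideal B L -> L u -> rank_one u.
Proof.
move=> hL Lu; have [p [pp p0 Lp upE hdiv]] := minimal_left_ideal_idempotent hL.
have pAp := gelfand_mazur pp p0 hdiv.
rewrite -(upE u Lu); apply: rank_oneMl => y; exact: pAp.
Qed.

Lemma rank_one_minimal_left_ideal u : rank_one u -> u <> 0 ->
  minimal_left_ideal B [set z : V | exists y : A, z = y * u].
Proof.
move=> hu u0; split.
- split; first by exists 0; rewrite mul0r.
    by move=> _ _ [a ->] [b ->]; exists (a - b); rewrite mulrBl.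
  by move=> a _ [b ->]; exists ((a : A) * b); rewrite -mulrA.
- move=> H; apply: u0; have : [set z : V | exists y : A, z = y * u] u.
    by exists 1; rewrite mul1r.
  by rewrite H.
- move=> M [M0 MB MM] ML.
  have [M00|/existsNP[z /not_implyP[Mz z0]]] := pselect (forall z, M z -> z = 0).
    by left; apply/seteqP; split=> [z /M00|z ->].
  right; apply/seteqP; split=> // _ [y ->]; apply: (MM (y : V)).
  have [t zE] := ML _ Mz.
  have [|w hw] := @rank_one_regular _ _ sp u t hu; first by rewrite -zE.
  by rewrite -hw -mulrA -zE; exact: MM.
Qed.

Lemma socleP x : socle B x <-> finite_rank x.
Proof.
split=> [[s [hs ->]]|[s [hs ->]]].
  by exists s; split=> // u us; have [L [hL Lu]] := hs u us;
    exact: minimal_left_ideal_rank_one Lu.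
(* Zero summands are dropped because only a nonzero [u] generates a minimal left ideal. *)
exists [seq u <- s | u != 0]; split.
  move=> u; rewrite mem_filter => /andP[/eqP u0 us].
  exists [set z : V | exists y : A, z = y * u]; split; last by exists 1; rewrite mul1r.
  exact: rank_one_minimal_left_ideal (hs u us) u0.
rewrite big_filter [RHS]big_mkcond /=; apply: eq_bigr => u _.
by case: eqP.
Qed.

(** The diagonalization gives one number [m] for both sides: [p] is a sum of at most [m] rank-one
    elements, and [y p] attains the [m] eigenvalues 1 to [m]. *)
Lemma alg_trace_rank p : finite_rank p -> p * p = p ->
  alg_trace p = (rank B p)%:R.
Proof.
move=> /finite_rank_le[n hn] pp.
have [m [y [f [trp mp yp hf]]]] := idempotent_diagonal sp hn pp.
rewrite trp; congr _%:R.
have hm : rank_bounded B p m.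
  move=> z; have [s [sm hs]] := rank_le_eigen sp mp z; exists s; split=> //.
  by move=> c [hc /eqP c0]; apply: hs.
have minm k : rank_bounded B p k -> (m <= k)%N.
  move=> /(_ y)[s [sk hs]]; apply: leq_trans sk.
  have inj : injective (fun i : nat => i.+1%:R : C) by move=> i j /eqP; rewrite eqr_nat => /eqP[].
  have := @uniq_leq_size _ [seq (i.+1%:R : C) | i <- iota 0 m] s.
  rewrite size_map size_iota; apply; first by rewrite map_inj_uniq ?iota_uniq.
  move=> _ /mapP[i + ->]; rewrite mem_iota add0n => /andP[_ im].
  have [f0 _ yf] := hf i im; apply: hs; split; last by move/eqP; rewrite pnatr_eq0.
  rewrite -[bmul B y p]/((y : A) * p) yp; exact: eigenvector_eigen f0 yf.
symmetry; apply: xget_subset1; first by split.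
by move=> i j [hi mi] [hj mj]; apply/eqP; rewrite eqn_leq mi ?mj.
Qed.

Lemma horner_alg_shift x (lam : C) (l : seq C) :
  horner_alg (x - lam *: 1) (vanishing_poly [seq c - lam | c <- l]) =
  horner_alg x (vanishing_poly l).
Proof.
elim: l => [|z l IH]; first by rewrite /vanishing_poly !big_nil !rmorph1.
rewrite /vanishing_poly /= !big_cons !rmorphM /= -!/(vanishing_poly _) IH.
by rewrite !horner_alg_XsubC scalerBl opprB addrA subrK.
Qed.

Lemma vanishing_poly_nseq (l : seq C) m :
  vanishing_poly (flatten (nseq m l)) = vanishing_poly l ^+ m.
Proof.
elim: m => [|m IH]; first by rewrite /vanishing_poly big_nil.
by rewrite exprS -IH /vanishing_poly /= big_cat.
Qed.

Lemma isolating_radius_exists (L : seq C) (lam : C) :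
  exists2 rho : R, 0 < rho & forall nu, nu \in L -> nu != lam -> rho < cmod (nu - lam).
Proof.
elim: L => [|z L [rho rho0 IH]]; first by exists 1.
have [->|zl] := eqVneq z lam.
  exists rho => // nu; rewrite inE => /orP[/eqP->|/IH//]; by rewrite eqxx.
have c0 : 0 < cmod (z - lam) by rewrite cmod_gt0 subr_eq0.
exists (Num.min rho (cmod (z - lam) / 2)); first by rewrite lt_min rho0 divr_gt0.
move=> nu; rewrite inE => /orP[/eqP-> _|nuL nul].
  by rewrite gt_min ltr_pdivrMr// ltr_pMr// ltr1n orbT.
by rewrite gt_min IH.
Qed.

Lemma binvP (u : V) : bunit B u ->
  bmul B u (binv B u) = bone B /\ bmul B (binv B u) u = bone B.
Proof. exact: xgetPex. Qed.

(** * The contour integral equals the polynomial Riesz idempotent *)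

Section RieszProjection.
Variables (x : A) (L : seq C) (m : nat) (e : C -> {poly C}).
Hypotheses (uL : uniq L) (hL : forall c, (c \in L) <-> eigen x c).
Hypothesis (h0 : horner_alg x (vanishing_poly L ^+ m.+1) = 0).
Hypothesis (he : forall mu, riesz_poly L m.+1 mu (e mu)).
Variable lam : C.
Hypothesis lamL : lam \in L.
Local Notation ev := (horner_alg x).

(** With [z = (x - lam) / rho], averaging over roots of unity gives [s_n - z ^+ n * s_n = 1] for the
    Riemann sums, and [spectral_projection_limit] identifies their limit. *)
Lemma riesz_integralE (rho : R) : 0 < rho ->
  (forall nu, nu \in L -> nu != lam -> rho < cmod (nu - lam)) ->
  riesz_integral B x lam rho%:C = ev (e lam).
Proof.
move=> rho0 hrho; pose Q := vanishing_poly (rem lam L).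
have rC : rho%:C != 0 by rewrite -cmod_gt0 cmod_real normr_gt0 gt_eqF.
have : coprimep (Q ^+ m.+1) ('X - lam%:P).
  by apply: coprimep_expl; rewrite coprimep_XsubC root_prod_XsubC mem_rem_uniqF.
case/Bezout_eq1_coprimepP => -[b a] /= ab.
have hQ : vanishing_poly L ^+ m.+1 %| Q ^+ m.+1 * (1 - e lam).
  rewrite (vanishing_poly_rem lamL) exprMn mulrC.
  by rewrite dvdp_mul2l ?expf_neq0 ?monic_neq0 ?monic_prod_XsubC//; case: (he lam).
pose z := rho%:C^-1 *: (x - lam *: 1).
(* By the Bezout relation [U] inverts [W] modulo [Q ^+ m.+1], so [t n] inverts [z ^+ n] on the
   complement of the idempotent. *)
pose U : {poly C} := rho%:C *: a; pose W : {poly C} := rho%:C^-1 *: ('X - lam%:P).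
have zE : z = ev W by rewrite horner_algZ horner_alg_XsubC.
pose t n := ev (U ^+ n * (1 - e lam)).
have tz n : t n.+1 * z = t n.
  rewrite /t zE -rmorphM; apply/eqP; rewrite -subr_eq0 -rmorphB; apply/eqP.
  apply: (horner_alg_dvd h0) => /=.
  have -> : U ^+ n.+1 * (1 - e lam) * W - U ^+ n * (1 - e lam) =
    - (U ^+ n * b) * (Q ^+ m.+1 * (1 - e lam)).
    have aE : a * ('X - lam%:P) = 1 - b * Q ^+ m.+1 by rewrite -ab addrAC subrr add0r.
    have UW : U * W = 1 - b * Q ^+ m.+1.
      by rewrite /U /W -scalerAl -scalerAr scalerA divff// scale1r aE.
    have -> : U ^+ n.+1 * (1 - e lam) * W = U ^+ n * (1 - e lam) * (U * W).
      by rewrite exprSr; ring.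
    by rewrite UW; ring.
  exact: dvdp_mull.
have idem : ev (e lam) * ev (e lam) = ev (e lam) := riesz_idempotent h0 he lamL.
apply: lim_nrm; apply: (@spectral_projection_limit _ _ _ nz (ev (e lam)) z _ t m.+1).
- move=> n n0.
  have rsE : riesz_sum B x lam rho%:C n = n%:R^-1 *: \sum_(k < n)
     ((rho%:C * unity_root R n k) *: (binv B ((lam + rho%:C * unity_root R n k) *: bone B - x) : A)).
    by [].
  rewrite rsE; apply: (unity_root_average n0
     (y := fun k : nat => (rho%:C * unity_root R n k) *:
       (binv B ((lam + rho%:C * unity_root R n k) *: bone B - x) : A))) => k kn.
  set w := unity_root R n k; have w0 : w != 0 := unity_root_neq0 R n k.
  set bi : A := binv _ _.
  have [hbi _] : ((lam + rho%:C * w) *: 1 - x) * bi = 1 /\ bi * ((lam + rho%:C * w) *: 1 - x) = 1.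
    apply: binvP.
    have nL : lam + rho%:C * w \notin L.
      apply/negP => H; have := hrho _ H; rewrite addrAC subrr add0r.
      rewrite cmodM cmod_real cmod_cis mulr1 gtr0_norm// ltxx => /(_ _)/negP; apply=> //.
      by rewrite -subr_eq0 addrAC subrr add0r mulf_neq0.
    have /contrapT[y [xy yx]] : ~ eigen x (lam + rho%:C * w).
      by move=> /hL; rewrite (negPf nL).
    exists (- y : A); split.
      rewrite -[LHS]/((((lam + rho%:C * w) *: 1 - x) : A) * - y).
      by rewrite mulrN -mulNr opprB xy.
    rewrite -[LHS]/((- y : A) * ((lam + rho%:C * w) *: 1 - x)).
    by rewrite mulNr -mulrN opprB yx.
  have E : (rho%:C * w) *: bi = 1 + (x - lam *: 1) * bi.
    rewrite -[X in X + _]hbi -mulrDl addrA subrK scalerDl addrAC subrr add0r.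
    by rewrite -scalerAl mul1r.
  rewrite {1}E; congr (_ + _).
  rewrite /z -scalerAl -scalerAr !scalerA -[LHS]scale1r; congr (_ *: _).
  by field; rewrite rC w0.
- rewrite zE -rmorphXn -rmorphM /W exprZn mulrC -scalerAl.
  by rewrite /= horner_algZ (riesz_nilpotent h0 he)// scaler0.
- by rewrite /t expr0 mul1r rmorphB rmorph1.
- exact: tz.
- move=> n; rewrite /t rmorphM -mulrA rmorphB rmorph1; congr (_ * _).
  by rewrite mulrBr mulr1 mulrBl mul1r /= idem subrr subr0.
- apply: (@decay _ _ _ nz (x - lam *: 1) rho
    [seq nu - lam | nu <- flatten (nseq m.+1 (rem lam L))]) => //.
  + move=> _ /mapP[nu /flattenP[l /nseqP[-> _] nul] ->].
    have := nul; rewrite mem_rem_uniq// inE => /andP[nl nuL].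
    exact: hrho.
  + move=> n; rewrite -(tz n) /z -scalerAr scalerA divff// scale1r.
    by rewrite -horner_alg_XsubC /t horner_alg_comm.
  + move=> n; rewrite horner_alg_shift vanishing_poly_nseq /t -rmorphM.
    apply: (horner_alg_dvd h0) => /=.
    by rewrite mulrCA dvdp_mull.
Qed.

Lemma riesz_projE : riesz_proj B x lam = ev (e lam).
Proof.
rewrite /riesz_proj.
have [rho rho0 hrho] := isolating_radius_exists L lam.
(* Isolating radii exist, so [xget] returns one instead of its default, and [riesz_integralE] covers
   whichever is chosen. *)
have hex : exists r, isolating_radius B x lam r.
  exists rho%:C; split; first by rewrite ltcR.
  move=> mu /hL muL; rewrite -[`|_|]/`|mu - lam| cmodE lecR => mul.
  by apply/eqP/negPn/negP => mn; have := hrho mu muL mn; rewrite ltNge mul.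
have [] := xgetPex (1 : C) hex; set r := xget _ _ => r0 hr.
have rE : r = (complex.Re r)%:C by rewrite RRe_real// gtr0_real.
rewrite rE; apply: riesz_integralE; first by rewrite -ltcR -rE.
move=> nu nuL; apply: contra_neqT => h; apply: hr; first exact/hL.
by rewrite rE cmodE lecR leNgt.
Qed.

End RieszProjection.

Lemma traceE x : finite_rank x -> trace B x = alg_trace x.
Proof.
move=> hx; have [L [m [uL hL h0]]] := finite_rank_eigen sp hx.
have [e he] := choice (fun mu => riesz_poly_exists m.+1 mu uL).
rewrite (alg_trace_riesz sp uL h0 he hx) /trace.
have -> : spectrum B x = [set` L] by apply/seteqP; split=> z /hL.
rewrite -fsbig_seq//; apply: eq_big_seq => mu muL.
rewrite /multiplicity (riesz_projE uL hL h0 he muL).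
(* The eigenvalue 0 contributes 0 whatever multiplicity is assigned to it. *)
have [->|mu0] := eqVneq mu 0; first by rewrite mulr0.
rewrite alg_trace_rank//; first exact: (riesz_finite_rank h0 he hx muL mu0).
exact: (riesz_idempotent h0 he muL).
Qed.

Lemma bpowE x n : bpow B x n = x ^+ n.
Proof. by elim: n => [|n IH]; rewrite ?exprS -?IH. Qed.

Lemma drazin_mod_soc x y : drazin_inv_mod_soc B x y <-> drazin_mod x y.
Proof.
split=> -[h1 h2 [k [k0 h3]]]; split; try exact/socleP; exists k; split=> //.
  by move: h3; rewrite bpowE => /socleP.
by rewrite bpowE; exact/socleP.
Qed.

Lemma bf_indexE x y : drazin_mod x y -> bf_index B x = commutator_trace x y.
Proof.
move=> hy; rewrite /bf_index.
have hex : exists b, drazin_inv_mod_soc B x b by exists y; apply/drazin_mod_soc.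
have /drazin_mod_soc := xgetPex (0 : V) hex; set a0 : A := xget _ _ => h.
have [xa0 _ _] := h; rewrite -[LHS]/(trace B ((x : A) * a0 - a0 * x : A)).
rewrite traceE//; apply: (tau_congr sp xa0); exact: drazin_mod_unique h hy.
Qed.

Lemma index_perturbation (a : A) : BFredholm B a -> exists2 eps : C, 0 < eps &
  forall lam : C, 0 < `|lam| < eps ->
    Fredholm B (a - lam *: 1) /\ bf_index B (a - lam *: 1) = bf_index B a.
Proof.
move=> [b /drazin_mod_soc hab]; have hb := nrm_ge0 (b : A).
(* This radius gives [lam *: b] norm at most 1/2, so that [1 - lam *: b] is invertible. *)
have e0 : 0 < (2 * (nrm (b : A) + 1))^-1 by rewrite invr_gt0 mulr_gt0// ltr_wpDl.
exists ((2 * (nrm (b : A) + 1))^-1)%:C; first by rewrite ltcR.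
move=> lam; rewrite cmodE ltcR ltcR cmod_gt0 => /andP[lam0 hlam].
have [r [br rb]] : invertible (1 - lam *: (b : A)).
  apply: invertible_1B; rewrite nrmZ.
  have h : cmod lam * (2 * (nrm (b : A) + 1)) < 1.
    by rewrite -ltr_pdivlMr ?mul1r// -invr_gt0.
  have := cmod_ge0 lam; nra.
have [h [ah ha th]] := fredholm_perturbation sp lam0 br rb hab.
split; first by exists h; split; apply/socleP.
(* An inverse modulo the socle is a Drazin inverse with exponent 1. *)
rewrite (bf_indexE hab) (@bf_indexE _ h); last first.
  split; first by have := finite_rankB ah ha; rewrite opprB addrA subrK.
    have := congr_soc_mul ha (congr_soc_refl h); by rewrite mul1r.
  exists 1%N; split=> //; rewrite expr1.
  have := congr_soc_mul ah (congr_soc_refl (a - lam *: 1)); by rewrite mul1r.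
rewrite -th /commutator_trace mulrBl mulrBr -scalerAl -scalerAr mul1r mulr1.
by congr alg_trace; rewrite opprB addrA subrK.
Qed.

End Socle.

Theorem theorem3p1 (R : realType) (A : completeNormedModType (complex R))
    (B : banach_algebra A) (a : A) :
  semisimple B -> BFredholm B a ->
  exists2 eps : complex R, 0 < eps &
    forall lam : complex R, 0 < `|lam| < eps ->
      Fredholm B (a - lam *: bone B) /\
      bf_index B (a - lam *: bone B) = bf_index B a.
Proof.
(* When the unit is 0 the algebra is trivial; otherwise the nontrivial ring structure [alg nz] is
   available. *)
move=> ss ha; have [e0|nz] := eqVneq (bone B) 0; last exact: (@index_perturbation R A B nz).
have all0 (x y : A) : x = y.
  have z0 (z : A) : z = 0.
    rewrite -(bmul1l B z) e0; have := bmulZl B 0 0 z; by rewrite !scale0r.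
  by rewrite (z0 x) (z0 y).
exists 1 => // lam _; rewrite (all0 (a - lam *: bone B) a); split=> //.
have s0 x : socle B x by exists [::]; split=> //; exact: all0.
by exists 0.
Qed.
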